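(* Suppose $\varepsilon\in(0,1]$ and $\beta\in\left(1-\max\{m_1,m_2\}^{-1},1\right)$. Then the Recency Weighted Sampler Markov chain with kernel $P$ on $\square(S)$ is uniformly ergodic, in the following sense: there exists a unique Borel probability measure $\mu^*_\varepsilon$ on $\square(S)$ with $\mu^*_\varepsilon P=\mu^*_\varepsilon$, and there is $\theta\in(0,1)$ such that for every $\alpha\ge 1$ there is a constant $c>0$, depending only on $\max_{x\in\square(S)}|x|$ and $\alpha$, with $$\left(W_\alpha(\nu P^n,\mu^*_\varepsilon)\right)^\alpha\le c\,\theta^n\qquad\text{for all } n\in\mathbb{N} \text{ and all Borel probability measures } \nu \text{ on } \square(S),$$ where $W_\alpha$ is the Wasserstein distance of order $\alpha$ on the Borel probability measures on $\square(S)$.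
   Context: Setting. $G$ is a finite two-player normal form game with roles $i\in\{1,2\}$ ($-i$ denotes the other role), pure strategy sets $S_1,S_2$ with $|S_i|=m_i$. $\Delta(S_i)$ is the set of mixed strategies, identified with the simplex of probability vectors in $\mathbb{R}^{m_i}$; $\square(S)=\Delta(S_1)\times\Delta(S_2)$ with the Euclidean distance. For $s\in S_i$, $\overrightarrow{1_{i,s}}\in\Delta(S_i)$ is the unit vector of the pure strategy $s$. For $\sigma\in\Delta(S_{-i})$, $BR_i(\sigma)\subset S_i$ is the set of pure best replies of player $i$ to $\sigma$. Parameters: sample size $k\in\mathbb{N}$, $k\geq 1$; recency parameter $\beta\in(0,1)$; error parameter $\varepsilon\in[0,1]$. Stochastic best reply. For $p\in\Delta(S_{-i})$, the random variable $\widetilde{BR}_i(p)\in S_i$ is generated as follows: draw $(n_s)_{s\in S_{-i}}$ from the multinomial distribution with parameters $k$ and $p$ and put $D=\frac1k\sum_{s\in S_{-i}}n_s\overrightarrow{1_{-i,s}}$; with probability $1-\varepsilon$ choose an element of $BR_i(D)$ uniformly at random; with probability $\varepsilon$ choose an element of $S_i$ uniformly at random. Recency Weighted Sampler (RWS). It is the Markov chain $p(t)=(p_1(t),p_2(t))$ on $\square(S)$ with $p_i(t+1)=\beta p_i(t)+(1-\beta)\overrightarrow{1_{i,s_i(t)}}$, $s_i(t)=\widetilde{BR}_i(p_{-i}(t))$, where, given $p(t)$, the two players' draws are independent of each other. Its transition kernel is $$P((p_1,p_2),B)=\sum_{s_1\in S_1}\sum_{s_2\in S_2}\mathbb{P}(\widetilde{BR}_1(p_2)=s_1)\,\mathbb{P}(\widetilde{BR}_2(p_1)=s_2)\,1_B\!\left(\beta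 p_1+(1-\beta)\overrightarrow{1_{1,s_1}},\,\beta p_2+(1-\beta)\overrightarrow{1_{2,s_2}}\right)$$ for Borel $B\subset\square(S)$. For a probability measure $\nu$, $\nu P^n$ denotes the law of $p(n)$ when $p(0)\sim\nu$. *)

(* Defs.v *)
From HB Require Import structures.
From mathcomp Require Import all_boot all_order all_algebra.
From mathcomp Require Import all_classical all_reals all_analysis.
From mathcomp Require Import measurable_realfun.
From mathcomp Require Import ring.

Set Implicit Arguments.
Unset Strict Implicit.
Unset Printing Implicit Defensive.

Import Order.TTheory GRing.Theory Num.Theory.
Import numFieldNormedType.Exports.

Local Open Scope classical_set_scope.
Local Open Scope ring_scope.

(* The strategy sets are S_1 = 'I_(nstrat1 G) and S_2 = 'I_(nstrat2 G). In both
   payoff matrices the row is the own strategy and the column that of the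
   opponent, so that both players can be handled by the same definitions. *)
Record game (R : realType) := Game {
  nstrat1 : nat;
  nstrat2 : nat;
  nstrat1_gt0 : (0 < nstrat1)%N;
  nstrat2_gt0 : (0 < nstrat2)%N;
  payoff1 : 'M[R]_(nstrat1, nstrat2);
  payoff2 : 'M[R]_(nstrat2, nstrat1) }.

Record rws_param (R : realType) := RwsParam {
  sample_size : nat;
  recency : R;
  error : R;
  sample_size_gt0 : (0 < sample_size)%N;
  recency_itv : 0 < recency < 1;
  error_itv : 0 <= error <= 1 }.

Section strategies.
Variable R : realType.

Definition simplex (n : nat) : set 'rV[R]_n :=
  [set p | (forall s, 0 <= p 0 s) /\ \sum_s p 0 s = 1].

Lemma simplex_delta n (s : 'I_n) : simplex (delta_mx 0 s).
Proof.
split=> [i|]; first by rewrite mxE; case: andP.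
rewrite (bigD1 s)//= mxE !eqxx big1 ?addr0// => i /negPf is_.
by rewrite mxE is_ andbF.
Qed.

Lemma simplex_conv n (b : R) (p q : 'rV[R]_n) : 0 < b < 1 ->
  simplex p -> simplex q -> simplex (b *: p + (1 - b) *: q).
Proof.
move=> /andP[b0 b1] [p0 p1] [q0 q1]; split=> [s|].
  by rewrite !mxE addr_ge0// mulr_ge0// ?subr_ge0 ltW.
under eq_bigr do rewrite !mxE.
by rewrite big_split/= -!mulr_sumr p1 q1; ring.
Qed.

Definition best_reply (m n : nat) (u : 'M[R]_(m, n)) (q : 'rV[R]_n)
    : {set 'I_m} :=
  [set s | [forall s', (u *m q^T) s' 0 <= (u *m q^T) s 0]]%SET.

Lemma best_reply_neq0 m n (u : 'M[R]_(m, n)) q :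
  (0 < m)%N -> best_reply u q != finset.set0.
Proof.
move=> m0; apply/finset.set0Pn; pose f s := (u *m q^T) s 0.
exists [arg max_(s > Ordinal m0) f s]%O.
rewrite finset.inE; apply/forallP => s'.
by case: arg_maxP => //= i _; exact.
Qed.

(* Probability of the vector of counts c under the multinomial distribution;
   meaningful for c of total k, which is the range of the sum in sbr_prob. *)
Definition multinomial_pmf (k n : nat) (p : 'rV[R]_n)
    (c : {ffun 'I_n -> 'I_k.+1}) : R :=
  k`!%:R / (\prod_s (c s)`!)%N%:R * \prod_s p 0 s ^+ c s.

Definition sample_mean (k n : nat) (c : {ffun 'I_n -> 'I_k.+1}) : 'rV[R]_n :=
  k%:R^-1 *: \sum_s (c s)%:R *: delta_mx 0 s.

Definition uniform_pmf (m : nat) (A : {set 'I_m}) (s : 'I_m) : R :=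
  (s \in A)%:R / #|A|%:R.

Lemma uniform_pmf_ge0 m A s : 0 <= @uniform_pmf m A s.
Proof. by rewrite mulr_ge0 ?invr_ge0 ?ler0n. Qed.

Lemma uniform_pmf_sum m (A : {set 'I_m}) :
  A != finset.set0 -> \sum_s uniform_pmf A s = 1.
Proof.
move=> A0; rewrite -mulr_suml -natr_sum -big_mkcond/= sum1_card divff//.
by rewrite pnatr_eq0 cards_eq0.
Qed.

Definition sbr_prob (par : rws_param R) (m n : nat) (u : 'M[R]_(m, n))
    (p : 'rV[R]_n) (s : 'I_m) : R :=
  (1 - error par) *
    (\sum_(c : {ffun 'I_n -> 'I_(sample_size par).+1}
            | (\sum_s' c s' == sample_size par)%N)
       multinomial_pmf p c * uniform_pmf (best_reply u (sample_mean c)) s)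
  + error par * uniform_pmf [set: 'I_m]%SET s.

Lemma multinomial_pmf_ge0 k n (p : 'rV[R]_n) (c : {ffun 'I_n -> 'I_k.+1}) :
  (forall s, 0 <= p 0 s) -> 0 <= multinomial_pmf p c.
Proof.
move=> p0; rewrite !mulr_ge0 ?invr_ge0 ?ler0n//.
by apply: prodr_ge0 => s _; rewrite exprn_ge0.
Qed.

Lemma multinomial_pmf_sum k n (p : 'rV[R]_n) :
  \sum_(c : {ffun 'I_n -> 'I_k.+1} | (\sum_s c s == k)%N) multinomial_pmf p c
    = (\sum_s p 0 s) ^+ k.
Proof.
pose E (x : R) : {poly R} := \poly_(i < k.+1) (x ^+ i / i`!%:R).
have fact0 i : i`!%:R != 0 :> R by rewrite pnatr_eq0 -lt0n fact_gt0.
have coE (s : seq 'I_n) j : (j <= k)%N ->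
    (\prod_(i <- s) E (p 0 i))`_j = (\sum_(i <- s) p 0 i) ^+ j / j`!%:R.
  elim: s j => [|i s IH] j jk.
    rewrite !big_nil coef1; case: j jk => [|j] _; first by rewrite divr1.
    by rewrite expr0n/= mul0r.
  rewrite !big_cons coefM addrC exprDn mulr_suml; apply: eq_bigr => l _.
  have lj : (l <= j)%N by rewrite -ltnS.
  rewrite coef_poly ltnS (leq_trans lj jk) IH; last first.
    by rewrite (leq_trans (leq_subr _ _)).
  rewrite -mulr_natl -(bin_fact lj) !natrM; field.
  by rewrite !fact0 pnatr_eq0 -lt0n bin_gt0 lj.
have := coE (index_enum 'I_n) k (leqnn k).
under eq_bigr do rewrite /E poly_def.
rewrite bigA_distr_bigA coef_sum => /(congr1 ( *%R k`!%:R)).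
rewrite mulrCA divff// mulr1 => <-; rewrite big_mkcond mulr_sumr/=.
apply: eq_bigr => c _; rewrite scaler_prod prodrXr coefZ coefXn eq_sym.
case: eqP => _; last by rewrite !mulr0.
by rewrite mulr1 /multinomial_pmf natr_prod prodf_div mulrA mulrAC.
Qed.

Lemma sbr_prob_ge0 par m n (u : 'M[R]_(m, n)) p s :
  simplex p -> 0 <= sbr_prob par u p s.
Proof.
move=> [p0 _]; have /andP[e0 e1] := error_itv par.
rewrite addr_ge0// mulr_ge0 ?subr_ge0 ?uniform_pmf_ge0//.
apply: sumr_ge0 => c _.
by rewrite mulr_ge0 ?multinomial_pmf_ge0 ?uniform_pmf_ge0.
Qed.

Lemma sbr_prob_sum par m n (u : 'M[R]_(m, n)) p :
  (0 < m)%N -> simplex p -> \sum_s sbr_prob par u p s = 1.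
Proof.
move=> m0 [_ p1]; rewrite big_split/= -!mulr_sumr exchange_big/=.
under eq_bigr do rewrite -mulr_sumr uniform_pmf_sum ?best_reply_neq0// mulr1.
rewrite multinomial_pmf_sum p1 expr1n uniform_pmf_sum; first by ring.
by rewrite -card_gt0 cardsT card_ord.
Qed.

End strategies.

Section state_space.
Variable R : realType.

Definition square (G : game R) : set ('rV[R]_(nstrat1 G) * 'rV[R]_(nstrat2 G)) :=
  @simplex R (nstrat1 G) `*` @simplex R (nstrat2 G).
Arguments square G : clear implicits.

(* This type carries the topology induced by that of the ambient matrices,
   which is the Euclidean one. *)
Definition state (G : game R) : Type := set_type (square G).

Variable G : game R.

HB.instance Definition _ := Choice.on (state G).
HB.instance Definition _ := Topological.copy (state G) (set_type (square G)).

Lemma square_delta : square G (delta_mx 0 (Ordinal (nstrat1_gt0 G)),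
                               delta_mx 0 (Ordinal (nstrat2_gt0 G))).
Proof. by split; exact: simplex_delta. Qed.

HB.instance Definition _ :=
  isPointed.Build (state G)
    (exist (fun x => x \in square G) _ (mem_set square_delta)).

HB.instance Definition _ := @isMeasurable.Build (sigma_display (@open (state G)))
  (state G) <<s @open (state G) >> (@sigma_algebra0 _ setT open) (@sigma_algebraC _ open)
  (@sigma_algebra_bigcup _ setT open).

Lemma stateP (x : state G) :
  simplex (val x).1 /\ simplex (val x).2.
Proof. exact: (set_mem (valP x)). Qed.

Lemma measurable_continuous_state (f : state G -> R) :
  continuous f -> measurable_fun setT f.
Proof.
move=> /continuousP cf; apply: (measurability _ (RGenOpens.measurableE R)).
move=> _ [_ [a [b ->] <-]]; rewrite setTI; apply: sub_sigma_algebra.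
exact/cf/interval_open.
Qed.

Lemma measurable_continuous_stateT (f : state G -> state G) :
  continuous f -> measurable_fun setT f.
Proof.
move=> /continuousP cf; apply: (measurability (@open (state G))) => //.
by move=> _ [U oU <-]; rewrite setTI; apply: sub_sigma_algebra; exact: cf.
Qed.

Lemma continuous_val : continuous (val : state G -> _).
Proof. exact: initial_continuous. Qed.

Lemma measurable_coord1 i : measurable_fun setT (fun x : state G => (val x).1 0 i).
Proof.
apply: measurable_continuous_state => x.
apply: (@continuous_comp _ _ _ (fun y : state G => (val y).1)
  (fun M : 'rV[R]_(nstrat1 G) => M 0 i)); last exact: coord_continuous.
apply: (@continuous_comp _ _ _ (val : state G -> _) fst); last exact: cvg_fst.
exact: continuous_val.
Qed.

Lemma measurable_coord2 i : measurable_fun setT (fun x : state G => (val x).2 0 i).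
Proof.
apply: measurable_continuous_state => x.
apply: (@continuous_comp _ _ _ (fun y : state G => (val y).2)
  (fun M : 'rV[R]_(nstrat2 G) => M 0 i)); last exact: coord_continuous.
apply: (@continuous_comp _ _ _ (val : state G -> _) snd); last exact: cvg_snd.
exact: continuous_val.
Qed.

End state_space.
Arguments square {R} G.

Section euclidean.
Variable R : realType.

Definition euclid_norm (m n : nat) (x : 'rV[R]_m * 'rV[R]_n) : R :=
  Num.sqrt (\sum_s x.1 0 s ^+ 2 + \sum_s x.2 0 s ^+ 2).

Definition euclid_dist (G : game R) (x y : state G) : R :=
  euclid_norm (val x - val y).

(* The supremum is a maximum, since square G is compact. *)
Definition max_norm (G : game R) : R := sup [set euclid_norm x | x in square G].

End euclidean.

Section rws_kernel.
Variables (R : realType) (G : game R) (par : rws_param R).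

Definition next_pair (x : 'rV[R]_(nstrat1 G) * 'rV[R]_(nstrat2 G))
    (s1 : 'I_(nstrat1 G)) (s2 : 'I_(nstrat2 G)) :=
  (recency par *: x.1 + (1 - recency par) *: delta_mx 0 s1,
   recency par *: x.2 + (1 - recency par) *: delta_mx 0 s2).

Lemma next_pair_square (x : state G) s1 s2 : square G (next_pair (val x) s1 s2).
Proof.
have [x1 x2] := stateP x.
by split; apply: simplex_conv => //; rewrite ?recency_itv//; exact: simplex_delta.
Qed.

Definition rws_next (x : state G) s1 s2 : state G :=
  exist (fun y => y \in square G) _ (mem_set (next_pair_square x s1 s2)).

Definition choice_prob1 (x : state G) (s1 : 'I_(nstrat1 G)) : R :=
  sbr_prob par (payoff1 G) (val x).2 s1.

Definition choice_prob2 (x : state G) (s2 : 'I_(nstrat2 G)) : R :=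
  sbr_prob par (payoff2 G) (val x).1 s2.

Definition rws_trans (x : state G) (B : set (state G)) : \bar R :=
  (\sum_s1 \sum_s2
    (choice_prob1 x s1 * choice_prob2 x s2)%:E * (\1_B (rws_next x s1 s2))%:E)%E.

Lemma choice_prob1_ge0 x s1 : 0 <= choice_prob1 x s1.
Proof. by apply: sbr_prob_ge0; case: (stateP x). Qed.

Lemma choice_prob2_ge0 x s2 : 0 <= choice_prob2 x s2.
Proof. by apply: sbr_prob_ge0; case: (stateP x). Qed.

Let rws_trans0 x : rws_trans x set0 = 0%E.
Proof.
by rewrite /rws_trans big1// => i _; rewrite big1// => j _; rewrite indic0 mule0.
Qed.

Let rws_trans_ge0 x B : (0 <= rws_trans x B)%E.
Proof.
apply: sume_ge0 => i _; apply: sume_ge0 => j _.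
by rewrite mule_ge0 ?lee_fin ?mulr_ge0 ?choice_prob1_ge0 ?choice_prob2_ge0.
Qed.

Let rws_trans_sigma_additive x : semi_sigma_additive (rws_trans x).
Proof.
move=> F mF tF mUF.
pose f (i : 'I_(nstrat1 G)) (j : 'I_(nstrat2 G)) (n : nat) : \bar R :=
  ((choice_prob1 x i * choice_prob2 x j)%:E * (\1_(F n) (rws_next x i j))%:E)%E.
have f0 i j n : (0 <= f i j n)%E.
  by rewrite mule_ge0 ?lee_fin ?mulr_ge0 ?choice_prob1_ge0 ?choice_prob2_ge0.
rewrite [X in _ --> X](_ : _ = lim ((fun n => \sum_(0 <= i < n)
    rws_trans x (F i))%E @ \oo)).
  by apply: is_cvg_ereal_nneg_natsum => k _; exact: rws_trans_ge0.
rewrite -/(\sum_(0 <= i <oo) rws_trans x (F i))%E.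
transitivity (\sum_(i < nstrat1 G) \sum_(0 <= n <oo) \sum_(j < nstrat2 G) f i j n)%E.
  apply: eq_bigr => i _; rewrite nneseries_sum//.
  apply: eq_bigr => j _; rewrite nneseriesZl//=.
  congr (_ * _)%E; rewrite -[LHS]/(dirac (rws_next x i j) _).
  exact: (@measure_semi_bigcup _ R (state G) (dirac (rws_next x i j)) F).
by rewrite -nneseries_sum// => i n _; apply: sume_ge0 => j _; exact: f0.
Qed.

HB.instance Definition _ x := isMeasure.Build _ _ _ (rws_trans x)
  (rws_trans0 x) (rws_trans_ge0 x) (@rws_trans_sigma_additive x).

Definition rws_kernel : state G -> {measure set (state G) -> \bar R} :=
  fun x => rws_trans x.

Lemma rws_kernel_setT x : rws_kernel x setT = 1%E.
Proof.
have [x1 x2] := stateP x.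
rewrite /rws_kernel/= /rws_trans.
under eq_bigr => i _.
  under eq_bigr do rewrite indicT mule1.
  rewrite sumEFin -mulr_sumr sbr_prob_sum ?nstrat2_gt0// mulr1; over.
by rewrite sumEFin sbr_prob_sum ?nstrat1_gt0.
Qed.

Lemma continuous_rws_next s1 s2 : continuous (fun x : state G => rws_next x s1 s2).
Proof.
apply: continuous_comp_initial => x.
have c1 : (next_pair (val y) s1 s2).1 @[y --> x] --> (next_pair (val x) s1 s2).1.
  apply: (@cvgD _ _ _ (nbhs x) _ (fun y : state G => recency par *: (val y).1)
    (cst ((1 - recency par) *: delta_mx 0 s1))); last exact: cvg_cst.
  apply: cvgZl_tmp; apply: (cvg_comp _ _ (@continuous_val _ _ x)).
  exact: cvg_fst.
have c2 : (next_pair (val y) s1 s2).2 @[y --> x] --> (next_pair (val x) s1 s2).2.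
  apply: (@cvgD _ _ _ (nbhs x) _ (fun y : state G => recency par *: (val y).2)
    (cst ((1 - recency par) *: delta_mx 0 s2))); last exact: cvg_cst.
  apply: cvgZl_tmp; apply: (cvg_comp _ _ (@continuous_val _ _ x)).
  exact: cvg_snd.
exact: (cvg_pair c1 c2).
Qed.

Lemma measurable_sbr_prob m n (u : 'M[R]_(m, n)) (p : state G -> 'rV[R]_n) s :
  (forall i, measurable_fun setT (fun x => p x 0 i)) ->
  measurable_fun setT (fun x => sbr_prob par u (p x) s).
Proof.
move=> mp; rewrite /sbr_prob; apply: measurable_funD => //.
apply: measurable_funM => //.
rewrite (_ : (fun x => _) = fun x =>
    \sum_(c : {ffun 'I_n -> 'I_(sample_size par).+1})
    (if (\sum_s' c s' == sample_size par)%N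
    then multinomial_pmf (p x) c * uniform_pmf R (best_reply u (sample_mean R c)) s
    else 0)); last by apply/funext => x; rewrite -big_mkcond.
apply: measurable_sum => c.
case: (\sum_s' c s' == sample_size par)%N => //.
rewrite /multinomial_pmf; apply: measurable_funM => //.
apply: measurable_funM => //.
by apply: measurable_prod => i _; exact: measurable_funX.
Qed.

Let measurable_rws_kernel B : measurable B -> measurable_fun setT (rws_kernel ^~ B).
Proof.
move=> mB; apply: emeasurable_sum => i; apply: emeasurable_sum => j.
apply: emeasurable_funM.
  apply/measurable_EFinP; apply: measurable_funM; apply: measurable_sbr_prob.
    exact: measurable_coord2.
  exact: measurable_coord1.
apply/measurable_EFinP; apply: measurableT_comp => //.
by apply: measurable_continuous_stateT; exact: continuous_rws_next.
Qed.

HB.instance Definition _ := @isKernel.Build _ _ _ _ R rws_kernel measurable_rws_kernel.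
HB.instance Definition _ :=
  @Kernel_isProbability.Build _ _ _ _ R rws_kernel rws_kernel_setT.

End rws_kernel.

Section kernel_step.
Context d (T : measurableType d) (R : realType).
Variables (P : R.-pker T ~> T) (nu : probability T R).

Definition kernel_step (B : set T) : \bar R := (\int[nu]_x P x B)%E.

Let kernel_step0 : kernel_step set0 = 0%E.
Proof. by apply: integral0_eq => y _; rewrite measure0. Qed.

Let kernel_step_ge0 B : (0 <= kernel_step B)%E.
Proof. by apply: integral_ge0. Qed.

Let kernel_step_sigma_additive : semi_sigma_additive kernel_step.
Proof.
move=> F mF tF mUF; rewrite [X in _ --> X](_ : _ = lim ((fun n =>
    \sum_(0 <= i < n) kernel_step (F i))%E @ \oo)).
  by apply: is_cvg_ereal_nneg_natsum => k _; exact: kernel_step_ge0.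
rewrite -/(\sum_(0 <= i <oo) kernel_step (F i))%E -integral_nneseries//.
  by apply: eq_integral => y _; exact: measure_semi_bigcup.
by move=> n; exact: measurable_kernel.
Qed.

HB.instance Definition _ := isMeasure.Build _ _ _ kernel_step
  kernel_step0 kernel_step_ge0 kernel_step_sigma_additive.

Let kernel_step_setT : kernel_step setT = 1%E.
Proof.
rewrite /kernel_step; under eq_integral do rewrite prob_kernel.
rewrite integral_cst// mul1e; exact: probability_setT.
Qed.

HB.instance Definition _ :=
  Measure_isProbability.Build _ _ _ kernel_step kernel_step_setT.

End kernel_step.

Section wasserstein.
Context d (T : measurableType d) (R : realType).

(* Equality of measures is required on measurable sets only: the values of a
   measure elsewhere carry no information. *)
Definition invariant_law (P : R.-pker T ~> T) (mu : probability T R) : Prop :=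
  forall B, measurable B -> kernel_step P mu B = mu B.

Definition law_at (P : R.-pker T ~> T) (nu : probability T R) (n : nat)
    : probability T R :=
  iter n (fun mu : probability T R => kernel_step P mu) nu.

(* For T = state G the product sigma-algebra on T * T is the Borel one, since
   the topology is second countable. *)
Definition coupling (mu nu : probability T R) : set (probability (T * T)%type R) :=
  [set pi | forall B, measurable B ->
    pi (B `*` setT) = mu B /\ pi (setT `*` B) = nu B].

Definition wasserstein (dist : T -> T -> R) (a : R) (mu nu : probability T R)
    : \bar R :=
  poweR (ereal_inf [set (\int[pi]_z (dist z.1 z.2 `^ a)%:E)%E
                   | pi in coupling mu nu]) a^-1.

End wasserstein.

(* Main.v *)
(* Couple two copies of the chain by a maximal coupling of the laws of their
   joint actions. When both copies choose the same actions, their distance is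
   multiplied by the recency parameter. This happens with probability at least
   error^2, and at least 1 - L t at distance t because the choice probabilities
   are Lipschitz. Hence a bounded increasing function V of the distance, with
   t / 4 <= V t <= 2, contracts by a factor theta at every step in mean. As the
   distance is at most 4, its power of order a is at most 4^a V, so that
   2 * 4^a is a suitable constant and theta does not depend on a.

   The contraction makes the iterates of the transfer operator converge on
   Lipschitz functions; the limit functional determines at most one invariant
   law. To realise it as a measure, let m w be the limit probability that the
   last |w| actions form the word w. Cutting [0, 1[ into consecutive intervals of
   lengths m w, which are refined as w is extended into the past, turns a uniform
   random point into a random infinite past; the image of Lebesgue measure under
   the map from a past to the state that it generates is the invariant law. *)
From HB Require Import structures.
Require Import Defs.
From mathcomp Require Import all_boot all_order all_algebra.
From mathcomp Require Import all_classical all_reals all_analysis.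
From mathcomp Require Import measurable_realfun.
From mathcomp Require Import ring lra.

Set Implicit Arguments.
Unset Strict Implicit.
Unset Printing Implicit Defensive.

Import Order.TTheory GRing.Theory Num.Theory.
Import numFieldNormedType.Exports.

Local Open Scope classical_set_scope.
Local Open Scope ring_scope.

(** * Maximal coupling and Lyapunov function *)

Section maximal_coupling.
Variables (R : realFieldType) (A : finType).
Implicit Types g : A -> R.

Definition overlap g g' : R := \sum_a Num.min (g a) (g' a).

Definition excess g g' a : R := Num.max (g a - g' a) 0.

(** The common mass sits on the diagonal and the two remainders are coupled independently. At
    overlap 1 the convention [x / 0 = 0] gives the right value, since no mass remains. *)
Definition max_coupling g g' (c : A * A) : R :=
  (c.1 == c.2)%:R * Num.min (g c.1) (g' c.1)
  + excess g g' c.1 * excess g' g c.2 / (1 - overlap g g').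

Lemma overlapC g g' : overlap g g' = overlap g' g.
Proof. by apply: eq_bigr => a _; rewrite minC. Qed.

Lemma excess_ge0 g g' a : 0 <= excess g g' a.
Proof. by rewrite le_max lexx orbT. Qed.

Lemma min_excess g g' a : Num.min (g a) (g' a) + excess g g' a = g a.
Proof.
by rewrite /excess; case: (leP (g a) (g' a)) => h;
  [rewrite max_r ?subr_le0// addr0 | rewrite max_l ?subr_ge0 1?ltW// subrKC].
Qed.

Lemma excess_sum g g' : \sum_a g a = 1 ->
  \sum_a excess g g' a = 1 - overlap g g'.
Proof.
move=> <-; rewrite -sumrB; apply: eq_bigr => a _.
by rewrite -[X in _ = X - _](min_excess g g') addrC addKr.
Qed.

Lemma overlap_le1 g g' : \sum_a g a = 1 -> overlap g g' <= 1.
Proof. by move=> <-; apply: ler_sum => a _; rewrite ge_min lexx. Qed.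

Lemma max_coupling_ge0 g g' c : (forall a, 0 <= g a) -> (forall a, 0 <= g' a) ->
  \sum_a g a = 1 -> 0 <= max_coupling g g' c.
Proof.
move=> g0 g'0 g1; rewrite addr_ge0 ?mulr_ge0 ?invr_ge0 ?subr_ge0 ?excess_ge0//.
  by rewrite le_min g0 g'0.
exact: overlap_le1.
Qed.

(** If the overlap is 1, the division is by 0, but then the nonnegative excesses sum to 0, so both
    sides vanish. *)
Lemma excess_divK g g' a : \sum_a g a = 1 ->
  excess g g' a * (1 - overlap g g') / (1 - overlap g g') = excess g g' a.
Proof.
move=> g1; case: (eqVneq (1 - overlap g g') 0) => [d0|/mulfK->//].
have /eqP := excess_sum g' g1.
rewrite d0 psumr_eq0; last by move=> *; exact: excess_ge0.
by move=> /allP/(_ a); rewrite mem_index_enum => /(_ isT)/eqP->; rewrite !mul0r.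
Qed.

Lemma max_coupling_suml g g' a : \sum_a g a = 1 -> \sum_a g' a = 1 ->
  \sum_a' max_coupling g g' (a, a') = g a.
Proof.
move=> g1 g'1; rewrite big_split/= (bigD1 a)//= eqxx mul1r big1 ?addr0; last first.
  by move=> i /negPf; rewrite eq_sym => ->; rewrite mul0r.
by rewrite -mulr_suml -mulr_sumr excess_sum// overlapC excess_divK// min_excess.
Qed.

Lemma max_coupling_sumr g g' a' : \sum_a g a = 1 -> \sum_a g' a = 1 ->
  \sum_a max_coupling g g' (a, a') = g' a'.
Proof.
move=> g1 g'1; rewrite big_split/= (bigD1 a')//= eqxx mul1r big1 ?addr0; last first.
  by move=> i /negPf->; rewrite mul0r.
rewrite -mulr_suml -mulr_suml excess_sum// [_ * excess _ _ _]mulrC overlapC.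
by rewrite excess_divK// minC min_excess.
Qed.

Lemma max_coupling_sum g g' : \sum_a g a = 1 -> \sum_a g' a = 1 ->
  \sum_c max_coupling g g' c = 1.
Proof.
move=> g1 g'1; rewrite -(pair_bigA _ (fun a b => max_coupling g g' (a, b)))/=.
by under eq_bigr do rewrite max_coupling_suml//.
Qed.

(** The term on the diagonal has mass [overlap g g']; the term made of the excesses has the
    remaining mass. *)
Lemma max_coupling_le g g' (F : A * A -> R) u v :
  (forall a, 0 <= g a) -> (forall a, 0 <= g' a) ->
  \sum_a g a = 1 -> \sum_a g' a = 1 ->
  (forall a, F (a, a) <= u) -> (forall c, F c <= v) ->
  \sum_c max_coupling g g' c * F c <= overlap g g' * u + (1 - overlap g g') * v.
Proof.
move=> g0 g'0 g1 g'1 Fu Fv; under eq_bigr do rewrite mulrDl.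
rewrite big_split/= lerD//.
  under eq_bigr do rewrite [X in F X]surjective_pairing.
  rewrite -(pair_bigA _ (fun a b => (a == b)%:R * Num.min (g a) (g' a) * F (a, b)))/=.
  rewrite mulr_suml ler_sum// => a _.
  rewrite (bigD1 a)//= eqxx mul1r big1 ?addr0; last first.
    by move=> i /negPf; rewrite eq_sym => ->; rewrite !mul0r.
  by rewrite ler_wpM2l// le_min g0 g'0.
apply: (@le_trans _ _
  (\sum_(c : A * A) excess g g' c.1 * excess g' g c.2 / (1 - overlap g g') * v)).
  apply: ler_sum => c _; rewrite ler_wpM2l// !mulr_ge0 ?excess_ge0// invr_ge0.
  by rewrite subr_ge0 overlap_le1.
rewrite -mulr_suml -mulr_suml.
rewrite -(pair_bigA _ (fun a b => excess g g' a * excess g' g b))/=.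
under eq_bigr do rewrite -mulr_sumr excess_sum// overlapC.
rewrite -mulr_suml excess_sum// [X in X <= _](_ : _ = (1 - overlap g g') * v)//.
case: (eqVneq (1 - overlap g g') 0) => [->|d0]; first by rewrite !mul0r.
by rewrite mulfK.
Qed.

End maximal_coupling.

(* The overlap of two laws of the joint actions is at least [p], and at least
   [1 - L t] at distance [t]. With [w = p / 2], the deficit
   [G = lyap_max - lyap] satisfies [p * G (b * t) >= 2 * G t] as long as
   [1 <= K * t]; for [K * t < 1], [lyap] is linear with a slope that dominates
   [L * lyap_max]. *)
Section lyapunov.
Variables (R : realType) (w K b : R) (N : nat).

Definition lyap (t : R) : R :=
  \sum_(i < N.+1) w ^+ i * Num.min 1 (K * b ^+ i * t).

Definition lyap_max : R := \sum_(i < N.+1) w ^+ i.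

Hypotheses (w0 : 0 < w) (K0 : 0 < K) (b0 : 0 < b) (b1 : b < 1).

Let wX_ge0 i : 0 <= w ^+ i. Proof. by rewrite exprn_ge0// ltW. Qed.

Let Kb_ge0 i : 0 <= K * b ^+ i.
Proof. by rewrite mulr_ge0 ?exprn_ge0// ltW. Qed.

Lemma le_lyap s t : s <= t -> lyap s <= lyap t.
Proof.
move=> st; apply: ler_sum => i _; apply: ler_wpM2l => //.
rewrite le_min ge_min lexx/= ge_min; apply/orP; right.
by apply: ler_wpM2l.
Qed.

Lemma lyap_le_max t : lyap t <= lyap_max.
Proof. by apply: ler_sum => i _; rewrite ler_piMr// ge_min lexx. Qed.

Lemma lyap_ge_min t : 0 <= t -> Num.min 1 (K * t) <= lyap t.
Proof.
move=> t0; rewrite /lyap big_ord_recl !expr0 mulr1 mul1r lerDl.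
by apply: sumr_ge0 => i _; rewrite mulr_ge0// le_min ler01 mulr_ge0.
Qed.

(** As [1 <= K * t], the term of index 0 is saturated and has no deficit. The factor [b] in the
    argument shifts the other terms by one index, which costs a factor [w]; the last term on the
    right is dropped. *)
Lemma lyap_deficit t : 0 <= t -> 1 <= K * t ->
  lyap_max - lyap t <= w * (lyap_max - lyap (b * t)).
Proof.
move=> t0 Kt; rewrite -!sumrB mulr_sumr big_ord_recl/= !expr0 mulr1 !mul1r.
rewrite min_l// subrr add0r big_ord_recr/= -[leLHS]addr0 lerD//; last first.
  rewrite mulr_ge0 ?(ltW w0)// subr_ge0 ler_piMr//.
  by rewrite ge_min lexx.
apply: ler_sum => i _; rewrite mulrBr /bump/= add1n !exprS.
have -> : K * (b * b ^+ i) * t = K * b ^+ i * (b * t) by ring.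
by rewrite -[_ * _ * Num.min _ _]mulrA.
Qed.

(** Since [b < 1], every minimum is attained by its linear argument at [t] and at [b * t]. *)
Lemma lyap_linear t : 0 <= t -> K * t <= 1 -> lyap (b * t) = b * lyap t.
Proof.
move=> t0 Kt; rewrite /lyap mulr_sumr; apply: eq_bigr => i _.
have H x : 0 <= x <= t -> K * b ^+ i * x <= 1.
  move=> /andP[x0 xt]; apply: le_trans Kt; rewrite -mulrA ler_wpM2l ?(ltW K0)//.
  apply: le_trans xt; rewrite ler_piMl//.
  by rewrite exprn_ile1// ltW.
rewrite !min_r ?H ?lexx ?t0//; first by ring.
by rewrite mulr_ge0 ?(ltW b0)//= ler_piMl// ltW.
Qed.

Lemma lyap_max_le2 : w <= 2^-1 -> lyap_max <= 2.
Proof.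
move=> w2; have -> : lyap_max = (1 - w ^+ N.+1) / (1 - w).
  apply/(canRL (mulfK _)); first by rewrite subr_eq0 eq_sym lt_eqF//; lra.
  by rewrite mulrC -opprB mulNr -subrX1 opprB.
rewrite ler_pdivrMr; last lra.
have := wX_ge0 N.+1; lra.
Qed.

End lyapunov.

(** Here [r] is the overlap at distance [t], so that the left side bounds the mean of [lyap] after a
    coupled step in which equal actions scale [t] by [b]. *)
Lemma exists_lyap (R : realType) (p L b D : R) :
  0 < p <= 1 -> 0 <= L -> 0 < b < 1 -> 0 < D ->
  exists w K N theta,
   [/\ 0 < w <= 2^-1, 1 <= K * D, 0 < K, 0 < theta < 1 &
     forall t r, 0 <= t <= D -> p <= r <= 1 -> 1 - L * t <= r ->
       r * lyap w K b N (b * t) + (1 - r) * lyap_max w N <= theta * lyap w K b N t].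
Proof.
move=> /andP[p0 p1] L0 /andP[b0 b1] D0.
(* The first summand of [K] gives [1 <= K * D]; the second makes the slope so steep that the loss
   [2 * L * t] is at most half of [(1 - b) * (K * t)]. *)
pose w := p / 2; pose K := D^-1 + 4 * L / (1 - b).
have w0 : 0 < w by rewrite divr_gt0.
have w2 : w <= 2^-1 by rewrite ler_piMl// invr_ge0.
have KL : 0 <= 4 * L / (1 - b) by rewrite divr_ge0 ?mulr_ge0// subr_ge0 ltW.
have K0 : 0 < K by rewrite ltr_pwDl// invr_gt0.
have KD : 1 <= K * D by rewrite mulrDl mulVf ?gt_eqF// lerDl mulr_ge0 ?(ltW D0).
(* For this [N] the last term is not saturated at [D], so the deficit [W - V D] is positive and the
   contraction at large [t] is strict. *)
have [N KN] : exists N, K * b ^+ N * D < 1.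
  have bN : b ^+ N @[N --> \oo] --> 0 by apply: cvg_expr; rewrite gtr0_norm.
  have /cvgrPdist_lt/(_ 1 ltr01)[N _ /(_ N (leqnn N))] :
      K * D * b ^+ N @[N --> \oo] --> K * D * 0 by apply: cvgMl_tmp.
  rewrite mulr0 sub0r normrN => h; exists N; rewrite mulrAC.
  exact: le_lt_trans (ler_norm _) h.
pose V := lyap w K b N; pose W := lyap_max w N.
have W2 : W <= 2 by exact: lyap_max_le2.
have VW t : V t <= W by apply: lyap_le_max.
have G0 : 0 < W - V D.
  rewrite -sumrB big_ord_recr/= ltr_wpDl//.
    apply: sumr_ge0 => i _; rewrite subr_ge0 ler_piMr ?exprn_ge0 ?(ltW w0)//.
    by rewrite ge_min lexx.
  by rewrite subr_gt0 gtr_pMr ?exprn_gt0// gt_min KN orbT.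
have W0 : 0 < W.
  rewrite /W /lyap_max big_ord_recl expr0 ltr_pwDl//.
  by apply: sumr_ge0 => i _; rewrite exprn_ge0// ltW.
(* The two bounds belong to the regimes [1 <= K * t] and [K * t < 1]. *)
pose th := Num.max (1 - (W - V D) / W) ((1 + b) / 2).
exists w, K, N, th; split=> //; first by rewrite w0 w2.
  apply/andP; split; first by rewrite lt_max; apply/orP; right; lra.
  by rewrite gt_max; apply/andP; split; [rewrite gtrBl divr_gt0 | lra].
move=> t r /andP[t0 tD] /andP[pr r1] rL; rewrite -/(V _) -/W -/(V t).
have V0 s : 0 <= s -> 0 <= V s.
  move=> s0; apply: le_trans (lyap_ge_min _ w0 K0 b0 s0).
  by rewrite le_min ler01 mulr_ge0// ltW.
have [Kt|Kt] := leP 1 (K * t).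
  (* As [w = p / 2], the left side is at most [W - 2 * (W - V t)], hence at most [V t - (W - V D)];
     then [V t <= W] yields the factor. *)
  apply: (@le_trans _ _ ((1 - (W - V D) / W) * V t)); last first.
    by rewrite ler_wpM2r ?V0// le_max lexx.
  have dG : W - V t <= w * (W - V (b * t)) by exact: lyap_deficit.
  have VtD : V t <= V D by exact: le_lyap.
  have : (W - V D) / W * V t <= W - V D.
    by rewrite mulrAC -mulrA ler_piMr ?(ltW G0)// ler_pdivrMr// mul1r.
  have : p * (W - V (b * t)) <= r * (W - V (b * t)) by rewrite ler_wpM2r// subr_ge0.
  by move: dG; rewrite /w; lra.
(* In the linear regime [V] shrinks by exactly [b], and the term with [1 - r] costs at most
   [2 * L * t], hence at most [(1 - b) / 2 * V t]. *)
apply: (@le_trans _ _ ((1 + b) / 2 * V t)); last first.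
  by rewrite ler_wpM2r ?V0// le_max lexx orbT.
have -> : V (b * t) = b * V t by apply: lyap_linear => //; exact: ltW.
have KV : K * t <= V t.
  by apply: le_trans (lyap_ge_min _ w0 K0 b0 t0); rewrite min_r// ltW.
have h1 : r * (b * V t) <= b * V t by rewrite ler_piMl// mulr_ge0 ?V0// ltW.
have h2 : (1 - r) * W <= L * t * 2.
  apply: ler_pM; rewrite ?subr_ge0 ?(ltW W0)//; lra.
have h3 : 4 * L * t <= (1 - b) * (K * t).
  rewrite mulrA ler_wpM2r// mulrDr [X in _ + X]mulrC divfK ?subr_eq0 ?gt_eqF//.
  by rewrite lerDr mulr_ge0 ?invr_ge0 ?(ltW D0)// subr_ge0 ltW.
have h4 : (1 - b) * (K * t) <= (1 - b) * V t by rewrite ler_wpM2l// subr_ge0 ltW.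
lra.
Qed.

(** * Lipschitz functions on the state space *)

Lemma cvg_sumr (R : realType) (T : Type) (F : set_system T) (FF : Filter F)
    (I : Type) (r : seq I) (f : I -> T -> R) (l : I -> R) :
  (forall i, f i x @[x --> F] --> l i) ->
  \sum_(i <- r) f i x @[x --> F] --> \sum_(i <- r) l i.
Proof. by move=> fl; apply: cvg_big => //; exact: add_continuous. Qed.

Section state_metric.
Variables (R : realType) (G : game R).
Implicit Types (x y z : state G) (h : state G -> R).

(** All estimates use this distance: it dominates the Euclidean one and defines the same topology,
    and Lipschitz bounds for it are sums over coordinates. *)
Definition l1_dist x y : R :=
  \sum_s `|(val x).1 0 s - (val y).1 0 s| + \sum_s `|(val x).2 0 s - (val y).2 0 s|.

Lemma l1_dist_ge0 x y : 0 <= l1_dist x y.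
Proof. by rewrite addr_ge0 ?sumr_ge0. Qed.

Lemma l1_distxx x : l1_dist x x = 0.
Proof. by rewrite /l1_dist !big1 ?addr0// => i _; rewrite subrr normr0. Qed.

Lemma l1_distC x y : l1_dist x y = l1_dist y x.
Proof. by congr (_ + _); apply: eq_bigr => s _; rewrite distrC. Qed.

Lemma l1_dist_triangle y x z : l1_dist x z <= l1_dist x y + l1_dist y z.
Proof.
by rewrite addrACA -!big_split lerD// ler_sum// => s _; exact: ler_distD.
Qed.

Lemma l1_dist_coord1 x y s : `|(val x).1 0 s - (val y).1 0 s| <= l1_dist x y.
Proof.
rewrite /l1_dist (bigD1 s)//= -addrA lerDl addr_ge0 ?sumr_ge0//.
Qed.

Lemma l1_dist_coord2 x y s : `|(val x).2 0 s - (val y).2 0 s| <= l1_dist x y.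
Proof.
by rewrite /l1_dist [X in _ <= _ + X](bigD1 s)//= addrCA lerDl addr_ge0 ?sumr_ge0.
Qed.

Lemma simplex_l1_le2 n (p q : 'rV[R]_n) : simplex p -> simplex q ->
  \sum_s `|p 0 s - q 0 s| <= 2.
Proof.
move=> [p0 p1] [q0 q1]; apply: (@le_trans _ _ (\sum_s (p 0 s + q 0 s))).
  by apply: ler_sum => s _; rewrite (le_trans (ler_normB _ _))// !ger0_norm.
by rewrite big_split/= p1 q1.
Qed.

Lemma l1_dist_le4 x y : l1_dist x y <= 4.
Proof.
have [x1 x2] := stateP x; have [y1 y2] := stateP y.
by rewrite (_ : 4 = 2 + 2); [rewrite lerD// simplex_l1_le2 | ring].
Qed.

Lemma sum_sqr_le (I : finType) (u : I -> R) : (forall i, 0 <= u i) ->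
  \sum_i u i ^+ 2 <= (\sum_i u i) ^+ 2.
Proof.
move=> u0; rewrite [leRHS]expr2 mulr_suml ler_sum// => i _.
by rewrite expr2 ler_wpM2l// (bigD1 i)//= lerDl sumr_ge0.
Qed.

Lemma euclid_dist_le x y : euclid_dist x y <= l1_dist x y.
Proof.
rewrite /euclid_dist /euclid_norm -[leRHS]ger0_norm ?l1_dist_ge0// -sqrtr_sqr.
apply: ler_wsqrtr; rewrite /l1_dist sqrrD.
have sq n (p q : 'rV[R]_n) :
    \sum_s (p - q) 0 s ^+ 2 <= (\sum_s `|p 0 s - q 0 s|) ^+ 2.
  apply: le_trans (sum_sqr_le _) => //; apply: ler_sum => s _.
  by rewrite real_normK ?num_real// !mxE.
rewrite addrAC ler_wpDr ?lerD ?sq//.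
by rewrite mulrn_wge0// mulr_ge0 ?sumr_ge0.
Qed.

Lemma euclid_dist_ge0 x y : 0 <= euclid_dist x y.
Proof. exact: sqrtr_ge0. Qed.

Lemma continuous_coord1 s : continuous (fun x => (val x).1 0 s).
Proof.
move=> x; apply: (@continuous_comp _ _ _ (fun y : state G => (val y).1)
  (fun M : 'rV[R]_(nstrat1 G) => M 0 s)); last exact: coord_continuous.
apply: (@continuous_comp _ _ _ (val : state G -> _) fst); last exact: cvg_fst.
exact: continuous_val.
Qed.

Lemma continuous_coord2 s : continuous (fun x => (val x).2 0 s).
Proof.
move=> x; apply: (@continuous_comp _ _ _ (fun y : state G => (val y).2)
  (fun M : 'rV[R]_(nstrat2 G) => M 0 s)); last exact: coord_continuous.
apply: (@continuous_comp _ _ _ (val : state G -> _) snd); last exact: cvg_snd.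
exact: continuous_val.
Qed.

Lemma continuous_l1_dist x : continuous (l1_dist x).
Proof.
move=> y; apply: (@cvgD _ _ _ (nbhs y) _
  (fun y => \sum_s `|(val x).1 0 s - (val y).1 0 s|)
  (fun y => \sum_s `|(val x).2 0 s - (val y).2 0 s|)).
- apply: (@cvg_sumr _ _ (nbhs y) _ _ _
    (fun s y => `|(val x).1 0 s - (val y).1 0 s|)) => s.
  by apply: cvg_norm; apply: cvgB; [exact: cvg_cst|exact: continuous_coord1].
- apply: (@cvg_sumr _ _ (nbhs y) _ _ _
    (fun s y => `|(val x).2 0 s - (val y).2 0 s|)) => s.
  by apply: cvg_norm; apply: cvgB; [exact: cvg_cst|exact: continuous_coord2].
Qed.

(** The topology comes from the sup-norm balls of the ambient matrices, and an [l1_dist] ball lies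
    in the sup-norm ball of the same radius. *)
Lemma closed_l1_dist (C : set (state G)) x : closed C -> ~ C x ->
  exists2 e, 0 < e & forall y, C y -> e <= l1_dist x y.
Proof.
move=> /closed_openC [V oV VC] Cx.
have Vx : V (val x) by rewrite -[V _]/((val @^-1` V) x) VC.
have /nbhs_ballP[e /= e0 eV] := open_nbhs_nbhs (conj oV Vx).
exists e => // y Cy; rewrite leNgt; apply/negP => xy.
suff /eV : ball (val x) e (val y).
  by rewrite -[V _]/((val @^-1` V) y) VC => /(_ Cy).
split; split=> // i j; rewrite ord1 /ball/= (le_lt_trans _ xy)//.
  exact: l1_dist_coord1.
exact: l1_dist_coord2.
Qed.

(** Boundedness is included to make the class stable under products; a single constant serves both
    bounds. *)
Definition bounded_lipschitz h := exists2 K, 0 <= K &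
  forall x y, `|h x| <= K /\ `|h x - h y| <= K * l1_dist x y.

Lemma bounded_lipschitz_measurable h : bounded_lipschitz h ->
  measurable_fun setT h.
Proof.
move=> [K K0 hK]; apply: measurable_continuous_state => x.
apply/(@cvgrPdist_le _ _ _ _ (@nbhs_filter (state G) x)) => e e0.
have K1 : 0 < K + 1 by rewrite ltr_wpDl.
have d0 : 0 < e / (K + 1) by rewrite divr_gt0.
have /cvgrPdist_lt/(_ _ d0) := @continuous_l1_dist x x.
apply: filterS => y; rewrite l1_distxx sub0r normrN ger0_norm ?l1_dist_ge0//.
move=> /ltW; rewrite ler_pdivlMr// => xy.
have [_ /le_trans->//] := hK x y; apply: le_trans xy.
by rewrite mulrC ler_wpM2l ?l1_dist_ge0// lerDl.
Qed.

Lemma bounded_lipschitz_cst c : bounded_lipschitz (fun=> c).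
Proof.
exists `|c| => // x y; split=> //.
by rewrite subrr normr0 mulr_ge0 ?l1_dist_ge0.
Qed.

Lemma bounded_lipschitzD h h' : bounded_lipschitz h -> bounded_lipschitz h' ->
  bounded_lipschitz (fun x => h x + h' x).
Proof.
move=> [K K0 hK] [K' K'0 hK']; exists (K + K'); first exact: addr_ge0.
move=> x y; have [h1 h2] := hK x y; have [h'1 h'2] := hK' x y; split.
  by rewrite (le_trans (ler_normD _ _))// lerD.
by rewrite opprD addrACA (le_trans (ler_normD _ _))// mulrDl lerD.
Qed.

Lemma bounded_lipschitzM h h' : bounded_lipschitz h -> bounded_lipschitz h' ->
  bounded_lipschitz (fun x => h x * h' x).
Proof.
(* The product has Lipschitz constant [2 * (K * K')] and bound [K * K']; the sum covers both. *)
move=> [K K0 hK] [K' K'0 hK']; exists (2 * (K * K') + K * K').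
  by rewrite addr_ge0 ?mulr_ge0.
move=> x y; have [h1 h2] := hK x y; have [h'1 h'2] := hK' x y; split.
  by rewrite normrM ler_wpDl ?mulr_ge0// ler_pM.
rewrite (_ : h x * h' x - _ = h x * (h' x - h' y) + (h x - h y) * h' y); last by ring.
have [h'y _] := hK' y y.
rewrite (le_trans (ler_normD _ _))// !normrM.
apply: (@le_trans _ _ (K * (K' * l1_dist x y) + K * l1_dist x y * K')).
  by rewrite lerD// ler_pM.
have := l1_dist_ge0 x y; set d := l1_dist x y => d0.
have : 0 <= K * K' * d by rewrite !mulr_ge0.
lra.
Qed.

Lemma bounded_lipschitz_sum (I : Type) (r : seq I) (P : pred I) (h : I -> state G -> R) :
  (forall i, P i -> bounded_lipschitz (h i)) ->
  bounded_lipschitz (fun x => \sum_(i <- r | P i) h i x).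
Proof.
move=> bh; elim: r => [|i r IH].
  under eq_fun do rewrite big_nil. exact: bounded_lipschitz_cst.
under eq_fun do rewrite big_cons.
case Pi: (P i) => //=.
by apply: bounded_lipschitzD => //; exact: bh.
Qed.

Lemma bounded_lipschitz_prod (I : Type) (r : seq I) (h : I -> state G -> R) :
  (forall i, bounded_lipschitz (h i)) ->
  bounded_lipschitz (fun x => \prod_(i <- r) h i x).
Proof.
move=> bh; elim: r => [|i r IH].
  under eq_fun do rewrite big_nil. exact: bounded_lipschitz_cst.
under eq_fun do rewrite big_cons.
by apply: bounded_lipschitzM.
Qed.

Lemma bounded_lipschitzX h n : bounded_lipschitz h ->
  bounded_lipschitz (fun x => h x ^+ n).
Proof.
move=> bh; elim: n => [|n IH]; first exact: bounded_lipschitz_cst.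
under eq_fun do rewrite exprS.
by apply: bounded_lipschitzM.
Qed.

Lemma simplex_le1 n (p : 'rV[R]_n) s : simplex p -> `|p 0 s| <= 1.
Proof.
by move=> [p0 <-]; rewrite ger0_norm// (bigD1 s)//= lerDl sumr_ge0.
Qed.

Lemma bounded_lipschitz_coord1 s : bounded_lipschitz (fun x => (val x).1 0 s).
Proof.
exists 1 => // x y; have [x1 x2] := stateP x; split; first exact: simplex_le1.
by rewrite mul1r l1_dist_coord1.
Qed.

Lemma bounded_lipschitz_coord2 s : bounded_lipschitz (fun x => (val x).2 0 s).
Proof.
exists 1 => // x y; have [x1 x2] := stateP x; split; first exact: simplex_le1.
by rewrite mul1r l1_dist_coord2.
Qed.

(** The best replies are taken at finitely many sample means that do not depend on [p], so
    [sbr_prob] is a polynomial in the coordinates of [p]. *)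
Lemma bounded_lipschitz_sbr_prob par m n (u : 'M[R]_(m, n)) (p : state G -> 'rV[R]_n) s :
  (forall i, bounded_lipschitz (fun x => p x 0 i)) ->
  bounded_lipschitz (fun x => sbr_prob par u (p x) s).
Proof.
move=> bp; apply: bounded_lipschitzD; last exact: bounded_lipschitz_cst.
apply: bounded_lipschitzM; first exact: bounded_lipschitz_cst.
apply: bounded_lipschitz_sum => c _.
apply: bounded_lipschitzM; last exact: bounded_lipschitz_cst.
apply: bounded_lipschitzM; first exact: bounded_lipschitz_cst.
by apply: bounded_lipschitz_prod => i; exact: bounded_lipschitzX.
Qed.

Definition inf_dist (C : set (state G)) x : R := inf [set l1_dist x y | y in C].

Lemma inf_dist_ge0 C x : 0 <= inf_dist C x.
Proof.
rewrite /inf_dist; set E := image _ _; have [->|/set0P E0] := eqVneq E set0.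
  by rewrite inf0.
by apply: lb_le_inf => // _ [y _ <-]; exact: l1_dist_ge0.
Qed.

Lemma inf_dist_le C x y : C y -> inf_dist C x <= l1_dist x y.
Proof.
move=> Cy; apply: ge_inf; last by exists y.
by exists 0 => _ [z _ <-]; exact: l1_dist_ge0.
Qed.

Lemma inf_dist_lipschitz C x y : C !=set0 ->
  inf_dist C x <= l1_dist x y + inf_dist C y.
Proof.
move=> [z0 Cz0]; rewrite -lerBlDl; apply: lb_le_inf; first by exists (l1_dist y z0), z0.
move=> _ [z Cz <-]; rewrite lerBlDl (le_trans (inf_dist_le x Cz))//.
exact: l1_dist_triangle.
Qed.

Lemma inf_dist_eq0 C x : closed C -> C !=set0 -> (inf_dist C x == 0) = (x \in C).
Proof.
move=> cC [y Cy]; apply/eqP/idP => [|/set_mem Cx]; last first.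
  by apply/eqP; rewrite eq_le inf_dist_ge0 andbT -(l1_distxx x) inf_dist_le.
move=> xC0; apply: mem_set; apply: contrapT => xC; have [e e0 eC] := closed_l1_dist cC xC.
suff : e <= inf_dist C x by rewrite xC0 leNgt e0.
by apply: lb_le_inf => [|_ [z Cz <-]]; [exists (l1_dist x y), y | exact: eC].
Qed.

Lemma bounded_lipschitz_inf_dist C : C !=set0 -> bounded_lipschitz (inf_dist C).
Proof.
move=> C0; exists 4 => // x y; split.
  rewrite ger0_norm ?inf_dist_ge0//; case: C0 => z Cz.
  exact: le_trans (inf_dist_le _ Cz) (l1_dist_le4 _ _).
apply: (@le_trans _ _ (l1_dist x y)); last by rewrite ler_peMl ?l1_dist_ge0// ler1n.
rewrite ler_norml lerBlDr inf_dist_lipschitz// andbT.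
by rewrite lerNl opprB lerBlDr l1_distC inf_dist_lipschitz.
Qed.

(* [1 - min 1 (n * inf_dist C)] decreases to the indicator of a closed [C]. *)
Definition bump_fun C n x : R := Num.max 0 (1 - n%:R * inf_dist C x).

Lemma bump_fun_ge0 C n x : 0 <= bump_fun C n x.
Proof. by rewrite le_max lexx. Qed.

Lemma bump_fun_le1 C n x : bump_fun C n x <= 1.
Proof. by rewrite ge_max ler01/= gerBl mulr_ge0 ?inf_dist_ge0. Qed.

Lemma bounded_lipschitz_bump C n : C !=set0 -> bounded_lipschitz (bump_fun C n).
Proof.
move=> C0; have [] : bounded_lipschitz (fun x => 1 + (- n%:R) * inf_dist C x).
  apply: bounded_lipschitzD; first exact: bounded_lipschitz_cst.
  apply: bounded_lipschitzM; first exact: bounded_lipschitz_cst.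
  exact: bounded_lipschitz_inf_dist.
move=> K K0 hK; exists (K + 1); first by rewrite addr_ge0.
move=> x y; have [_ hxy] := hK x y; split.
  by rewrite ger0_norm ?bump_fun_ge0// ler_wpDl// bump_fun_le1.
apply: (@le_trans _ _ (K * l1_dist x y)); last first.
  by rewrite ler_wpM2r ?l1_dist_ge0// lerDl.
(* The maximum with 0 is 1-Lipschitz, so the bound for the untruncated function suffices. *)
apply: le_trans hxy; rewrite /bump_fun !mulNr.
set a := 1 - _; set b := 1 - _.
by case: (leP 0 a); case: (leP 0 b) => hb ha; rewrite ?subrr ?normr0//;
  rewrite ?subr0 ?sub0r ?normrN;
  rewrite ler_norml; apply/andP; split;
  have := ler_norm (a - b); have := ler_norm (b - a); rewrite (distrC b a); lra.
Qed.

Lemma cvg_bump_fun C x : closed C -> C !=set0 ->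
  bump_fun C n x @[n --> \oo] --> (\1_C x : R).
Proof.
move=> cC C0; rewrite indicE -(inf_dist_eq0 x cC C0).
have [d0|dN0] := eqVneq (inf_dist C x) 0.
  rewrite /bump_fun d0; under eq_fun do rewrite mulr0 subr0 max_r//.
  exact: cvg_cst.
have d0 : 0 < inf_dist C x by rewrite lt_neqAle eq_sym dN0 inf_dist_ge0.
apply: cvg_near_cst; near=> n; apply: max_l; rewrite subr_le0 -ler_pdivrMr//.
by rewrite ltW//; near: n; exact: nbhs_infty_gtr.
Unshelve. all: by end_near. Qed.

End state_metric.

(** * Kernels *)

Section integral_kernel_step.
Context d (T : measurableType d) (R : realType).
Variables (P : R.-pker T ~> T) (nu : probability T R).
Local Open Scope ereal_scope.

Let cst_kernel := @kprobability _ _ unit T R (fun=> nu : pprobability T R)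
  (measurable_cst (nu : pprobability T R)).

(** In a composition the second kernel also sees the source of the first, so [P] is read as a kernel
    from [unit * T]. *)
Definition snd_kernel (z : unit * T) : {measure set T -> \bar R} := P z.2.

Let measurable_snd_kernel U : measurable U ->
  measurable_fun setT (snd_kernel ^~ U).
Proof.
move=> mU; exact: (measurableT_comp (measurable_kernel P U mU) measurable_snd).
Qed.

HB.instance Definition _ :=
  @isKernel.Build _ _ _ _ R snd_kernel measurable_snd_kernel.

Let snd_kernel_setT z : snd_kernel z setT = 1.
Proof. exact: prob_kernel. Qed.

HB.instance Definition _ :=
  @Kernel_isProbability.Build _ _ _ _ R snd_kernel snd_kernel_setT.

(** With [nu] as a constant kernel from [unit], this is the integration formula for composed
    kernels. *)
Lemma integral_kernel_step (f : T -> \bar R) :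
  (forall x, 0 <= f x) -> measurable_fun setT f ->
  \int[kernel_step P nu]_x f x = \int[nu]_x \int[P x]_y f y.
Proof.
move=> f0 mf; rewrite -[RHS](integral_kcomp cst_kernel snd_kernel tt f0 mf).
exact: eq_measure_integral.
Qed.

End integral_kernel_step.

Section finite_mixture.
Context d (T : measurableType d) (R : realType) (I : finType).
Variables (wt : I -> T -> R) (nx : I -> T -> T).
Hypotheses (wt_ge0 : forall i x, 0 <= wt i x)
  (wt_sum : forall x, \sum_i wt i x = 1)
  (measurable_wt : forall i, measurable_fun setT (wt i))
  (measurable_nx : forall i, measurable_fun setT (nx i)).

(* The unused arguments let the kernel structure of [mixture] be inferred. *)
Definition mixture of (forall x, \sum_i wt i x = 1)
    & (forall i, measurable_fun setT (wt i))
    & (forall i, measurable_fun setT (nx i)) :=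
  fun x => foldr (fun i (m : {measure set T -> \bar R}) =>
      measure_add (mscale (NngNum (wt_ge0 i x)) \d_(nx i x)) m : {measure set T -> \bar R})
    (mzero : {measure set T -> \bar R}) (index_enum I).

Local Notation mix := (mixture wt_sum measurable_wt measurable_nx).

Lemma mixtureE x B : mix x B = (\sum_i (wt i x * \1_B (nx i x))%:E)%E.
Proof.
rewrite /mixture; elim: (index_enum I) => [|i s IH]; first by rewrite big_nil.
rewrite big_cons -IH EFinM.
exact: (measure_addE (mscale (NngNum (wt_ge0 i x)) \d_(nx i x)) _).
Qed.

Lemma integral_mixture x (f : T -> \bar R) :
  (forall y, 0 <= f y)%E -> measurable_fun setT f ->
  (\int[mix x]_y f y = \sum_i (wt i x)%:E * f (nx i x))%E.
Proof.
move=> f0 mf; rewrite /mixture; elim: (index_enum I) => [|i s IH].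
  by rewrite big_nil integral_measure_zero.
rewrite big_cons -IH; set m := foldr _ _ s.
rewrite [LHS](ge0_integral_measure_add
  (mscale (NngNum (wt_ge0 i x)) \d_(nx i x)) m)//.
by rewrite ge0_integral_mscale// integral_dirac// diracT mul1e.
Qed.

Let measurable_mixture B : measurable B -> measurable_fun setT (mix ^~ B).
Proof.
move=> mB; under eq_fun do rewrite mixtureE; apply: emeasurable_sum => i.
apply/measurable_EFinP; apply: measurable_funM => //.
exact: measurableT_comp.
Qed.

HB.instance Definition _ := @isKernel.Build _ _ _ _ R mix measurable_mixture.

Let mixture_setT x : mix x setT = 1%E.
Proof.
rewrite mixtureE; under eq_bigr do rewrite indicT mulr1.
by rewrite sumEFin wt_sum.
Qed.

HB.instance Definition _ := @Kernel_isProbability.Build _ _ _ _ R mix mixture_setT.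

End finite_mixture.

(** * The contracting coupling of two chains *)

Lemma cvg_geometric_increments (R : realType) (u : R^nat) (C q : R) :
  0 < q < 1 -> (forall n, `|u n.+1 - u n| <= C * q ^+ n) ->
  cvgn u /\ forall n, `|u n - limn u| <= C * q ^+ n / (1 - q).
Proof.
move=> /andP[q0 q1] uC.
have C0 : 0 <= C by have := uC 0%N; rewrite expr0 mulr1; exact: le_trans.
(* Keeping the exact partial geometric sum, with its factor [1 - q ^+ k], lets the induction on [k]
   close. *)
have B n k : `|u (n + k)%N - u n| <= C * q ^+ n / (1 - q) * (1 - q ^+ k).
  elim: k => [|k IH]; first by rewrite addn0 !subrr normr0 mulr0.
  rewrite addnS -(subrKA (u (n + k)%N)) (le_trans (ler_normD _ _))//.
  rewrite (le_trans (lerD (uC _) IH))// -subr_ge0 exprD exprS.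
  rewrite le_eqVlt; apply/orP; left; apply/eqP; field.
  by rewrite subr_eq0 gt_eqF.
have B' n k : `|u (n + k)%N - u n| <= C * q ^+ n / (1 - q).
  apply: le_trans (B n k) _; rewrite ler_piMr ?divr_ge0 ?mulr_ge0 ?exprn_ge0 ?(ltW q0)//.
    by rewrite subr_ge0 ltW.
  by rewrite gerBl exprn_ge0// ltW.
have cu : cvgn u.
  apply/cauchy_cvgP/cauchyP => e e0.
  have bn : C * q ^+ n / (1 - q) @[n --> \oo] --> C * 0 / (1 - q).
    apply: cvgMr_tmp; apply: cvgMl_tmp; apply: cvg_expr.
    by rewrite gtr0_norm.
  have {bn}/cvgrPdist_lt/(_ e e0)[N _ /(_ N (leqnn N))] := bn.
  rewrite mulr0 mul0r sub0r normrN => bN; exists (u N), N => // m /= Nm.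
  rewrite /ball/= distrC -(subnKC Nm); apply: le_lt_trans (B' _ _) _.
  exact: le_lt_trans (ler_norm _) bN.
split=> // n.
have cv : `|u n - u k| @[k --> \oo] --> `|u n - limn u|.
  by apply: cvg_norm; apply: cvgB => //; exact: cvg_cst.
apply: (cvgr_to_le cv); exists n => // k /= nk.
by rewrite distrC -(subnKC nk).
Qed.

Section chain.
Variables (R : realType) (G : game R) (par : rws_param R).
Implicit Types (x y : state G) (h : state G -> R).

Definition action := ('I_(nstrat1 G) * 'I_(nstrat2 G))%type.

Definition next_state x (a : action) : state G := rws_next par x a.1 a.2.

Definition action_prob x (a : action) : R :=
  choice_prob1 par x a.1 * choice_prob2 par x a.2.

Lemma action_prob_ge0 x a : 0 <= action_prob x a.
Proof. by rewrite mulr_ge0 ?choice_prob1_ge0 ?choice_prob2_ge0. Qed.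

Lemma action_prob_sum x : \sum_a action_prob x a = 1.
Proof.
have [x1 x2] := stateP x.
rewrite -(pair_bigA _ (fun i j => choice_prob1 par x i * choice_prob2 par x j))/=.
under eq_bigr do rewrite -mulr_sumr sbr_prob_sum ?nstrat2_gt0// mulr1.
by rewrite sbr_prob_sum ?nstrat1_gt0.
Qed.

Lemma sbr_prob_ge m n (u : 'M[R]_(m, n)) p s : simplex p ->
  error par / m%:R <= sbr_prob par u p s.
Proof.
move=> [p0 p1]; have /andP[e0 e1] := error_itv par.
rewrite /sbr_prob -[leLHS]add0r lerD//; last first.
  by rewrite /uniform_pmf finset.in_setT cardsT card_ord mul1r.
rewrite mulr_ge0 ?subr_ge0// sumr_ge0// => c _.
by rewrite mulr_ge0 ?multinomial_pmf_ge0 ?uniform_pmf_ge0.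
Qed.

(** In every state, errors of both players alone give each joint action probability at least
    [error par ^+ 2] divided by the number of joint actions. *)
Lemma overlap_ge x y :
  error par ^+ 2 <= overlap (action_prob x) (action_prob y).
Proof.
have m1 : (nstrat1 G)%:R != 0 :> R by rewrite pnatr_eq0 -lt0n nstrat1_gt0.
have m2 : (nstrat2 G)%:R != 0 :> R by rewrite pnatr_eq0 -lt0n nstrat2_gt0.
have /andP[e0 e1] := error_itv par.
apply: (@le_trans _ _ (\sum_(a : action)
    (error par / (nstrat1 G)%:R * (error par / (nstrat2 G)%:R)))).
  rewrite sumr_const card_prod !card_ord -[_ *+ (_ * _)]mulr_natr natrM le_eqVlt.
  apply/orP; left; apply/eqP; field.
  by rewrite m1 m2.
apply: ler_sum => a _; rewrite le_min.
have [x1 x2] := stateP x; have [y1 y2] := stateP y.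
by apply/andP; split; apply: ler_pM; rewrite ?divr_ge0 ?sbr_prob_ge.
Qed.

Lemma bounded_lipschitz_action_prob a : bounded_lipschitz (action_prob^~ a).
Proof.
apply: bounded_lipschitzM; apply: bounded_lipschitz_sbr_prob => i.
  exact: bounded_lipschitz_coord2.
exact: bounded_lipschitz_coord1.
Qed.

(** The complement of the overlap is a sum of excesses, each at most a difference of action
    probabilities, which are Lipschitz. *)
Lemma overlap_lipschitz : exists2 L, 0 <= L &
  forall x y, 1 - L * l1_dist x y <= overlap (action_prob x) (action_prob y).
Proof.
have /choice[K hK] : forall a, exists K, 0 <= K /\
    forall x y, `|action_prob x a - action_prob y a| <= K * l1_dist x y.
  move=> a; have [K K0 hK] := bounded_lipschitz_action_prob a.
  by exists K; split=> // x y; have [] := hK x y.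
exists (\sum_a K a); first by apply: sumr_ge0 => a _; have [] := hK a.
move=> x y; rewrite lerBlDr -lerBlDl -(excess_sum _ (action_prob_sum x)).
rewrite mulr_suml ler_sum// => a _; have [Ka /(_ x y) xy] := hK a.
rewrite ge_max mulr_ge0 ?l1_dist_ge0// andbT.
exact: le_trans (ler_norm _) xy.
Qed.

(** Both states move towards the same vertex, which cancels in the difference. *)
Lemma l1_dist_next x y a :
  l1_dist (next_state x a) (next_state y a) = recency par * l1_dist x y.
Proof.
have /andP[b0 _] := recency_itv par.
rewrite /l1_dist mulrDr !mulr_sumr; congr (_ + _); apply: eq_bigr => s _;
  by rewrite /= !mxE opprD addrACA subrr addr0 -mulrBr normrM gtr0_norm.
Qed.

Lemma rws_kernelE x B : rws_kernel par x B =
  (\sum_a (action_prob x a * \1_B (next_state x a))%:E)%E.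
Proof.
rewrite -(pair_bigA _ (fun i j => (choice_prob1 par x i * choice_prob2 par x j
  * \1_B (rws_next par x i j))%:E))/=.
by apply: eq_bigr => i _; apply: eq_bigr => j _; rewrite EFinM.
Qed.

Lemma integral_rws_kernel x (f : state G -> \bar R) :
  (forall y, 0 <= f y)%E -> measurable_fun setT f ->
  (\int[rws_kernel par x]_y f y = \sum_a (action_prob x a)%:E * f (next_state x a))%E.
Proof.
move=> f0 mf.
rewrite -(integral_mixture (fun a x => action_prob_ge0 x a) action_prob_sum
   (fun a => bounded_lipschitz_measurable (bounded_lipschitz_action_prob a))
   (fun a => measurable_continuous_stateT (@continuous_rws_next _ _ par a.1 a.2)))//.
by apply: eq_measure_integral => A mA _; rewrite mixtureE rws_kernelE.
Qed.

(** Equal actions scale the distance by [recency par], any other pair costs at most [lyap_max];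
    [exists_lyap] is applied with [D = 4], the bound for [l1_dist]. *)
Lemma lyapunov_contraction : 0 < error par ->
  exists (V : R -> R) theta,
  [/\ 0 < theta < 1, measurable_fun setT V,
      forall t, 0 <= t <= 4 -> t / 4 <= V t <= 2 &
      forall x y, \sum_c max_coupling (action_prob x) (action_prob y) c *
          V (l1_dist (next_state x c.1) (next_state y c.2)) <= theta * V (l1_dist x y)].
Proof.
move=> e0; have [L L0 xyL] := overlap_lipschitz.
have /andP[_ e1] := error_itv par.
have /andP[b0 b1] := recency_itv par.
have p01 : 0 < error par ^+ 2 <= 1 by rewrite exprn_gt0// exprn_ile1// ltW.
have [w [K [N [th [/andP[w0 w2] KD K0 th01 Vth]]]]] :=
  @exists_lyap R _ L (recency par) 4 p01 L0 (recency_itv par) (ltr0n _ 4).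
exists (lyap w K (recency par) N), th; split=> //.
- apply: measurable_sum => i; apply: measurable_funM => //.
  by apply: measurable_minr => //; exact: measurable_funM.
(* As [1 <= K * 4], both arguments of the minimum in [lyap_ge_min] are at least [t / 4]. *)
- move=> t /andP[t0 t4]; apply/andP; split.
    apply: le_trans (lyap_ge_min _ w0 K0 b0 t0); rewrite le_min.
    have : t <= K * 4 * t by rewrite ler_peMl.
    by rewrite ler_pdivrMr// mul1r t4/=; lra.
  apply: (@le_trans _ _ (lyap_max w N)); first exact: lyap_le_max.
  exact: lyap_max_le2.
move=> x y; set r := overlap (action_prob x) (action_prob y).
apply: le_trans (Vth _ r _ _ _); rewrite ?l1_dist_ge0 ?l1_dist_le4//; last first.
  by rewrite overlap_ge overlap_le1// action_prob_sum.
apply: max_coupling_le => // [a|a|||a|c]; rewrite ?action_prob_sum//.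
- exact: action_prob_ge0.
- exact: action_prob_ge0.
- by rewrite l1_dist_next.
- exact: lyap_le_max.
Qed.

End chain.

(** * The transfer operator and its ergodic mean *)

Section transfer_operator.
Variables (R : realType) (G : game R) (par : rws_param R).
Implicit Types (x y : state G) (h : state G -> R).

Local Notation next_state := (next_state par).
Local Notation action_prob := (action_prob par).

Definition step h x : R := \sum_a action_prob x a * h (next_state x a).

Lemma stepE h x : step h x = \sum_a action_prob x a * h (next_state x a).
Proof. by []. Qed.

Lemma bounded_lipschitz_next h a : bounded_lipschitz h ->
  bounded_lipschitz (fun x => h (next_state x a)).
Proof.
move=> [K K0 hK]; exists K => // x y.
have [h1 h2] := hK (next_state x a) (next_state y a); split=> //.
apply: le_trans h2 _; rewrite l1_dist_next ler_wpM2l//.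
have /andP[b0 b1] := recency_itv par.
by rewrite ler_piMl ?l1_dist_ge0// ltW.
Qed.

Lemma bounded_lipschitz_step h : bounded_lipschitz h -> bounded_lipschitz (step h).
Proof.
move=> bh; apply: bounded_lipschitz_sum => a _; apply: bounded_lipschitzM.
  exact: bounded_lipschitz_action_prob.
exact: bounded_lipschitz_next.
Qed.

Lemma bounded_lipschitz_iter_step h n : bounded_lipschitz h ->
  bounded_lipschitz (iter n step h).
Proof. by move=> bh; elim: n => //= n; exact: bounded_lipschitz_step. Qed.

Lemma le_iter_step h h' n x : (forall y, h y <= h' y) ->
  iter n step h x <= iter n step h' x.
Proof.
move=> hh'; elim: n x => //= n IH x; apply: ler_sum => a _.
by rewrite ler_wpM2l// action_prob_ge0.
Qed.

Lemma step_dist h c x l : (forall a, `|h (next_state x a) - l| <= c) ->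
  `|step h x - l| <= c.
Proof.
move=> hc; rewrite stepE -[l]mul1r -(action_prob_sum par x) mulr_suml -sumrB.
apply: le_trans (ler_norm_sum _ _ _) _.
rewrite -[leRHS]mul1r -(action_prob_sum par x) mulr_suml ler_sum// => a _.
by rewrite -mulrBr normrM ger0_norm ?action_prob_ge0// ler_wpM2l ?action_prob_ge0.
Qed.

Lemma iter_step_dist h h' c n x : (forall y, `|h y - h' y| <= c) ->
  `|iter n step h x - iter n step h' x| <= c.
Proof.
move=> hh'; elim: n x => //= n IH x; rewrite !stepE -sumrB.
apply: le_trans (ler_norm_sum _ _ _) _.
rewrite -[leRHS]mul1r -(action_prob_sum par x) mulr_suml ler_sum// => a _.
by rewrite -mulrBr normrM ger0_norm ?action_prob_ge0// ler_wpM2l ?action_prob_ge0.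
Qed.

Lemma iter_step_cst c n x : iter n step (fun=> c) x = c.
Proof.
elim: n x => //= n IH x; rewrite stepE; under eq_bigr do rewrite IH.
by rewrite -mulr_suml action_prob_sum mul1r.
Qed.

Lemma iter_step_sum (I : Type) (r : seq I) (c : I -> R) (h : I -> state G -> R) n x :
  iter n step (fun y => \sum_(i <- r) c i * h i y) x
  = \sum_(i <- r) c i * iter n step (h i) x.
Proof.
elim: n x => //= n IH x; rewrite stepE; under [LHS]eq_bigr do rewrite IH mulr_sumr.
rewrite exchange_big/=; apply: eq_bigr => i _; rewrite mulr_sumr.
by apply: eq_bigr => a _; rewrite mulrCA.
Qed.

(** The marginals of the coupling are the action laws at [x] and at [y]. *)
Lemma step_coupling h x y : step h x - step h y =
  \sum_c max_coupling (action_prob x) (action_prob y) c *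
    (h (next_state x c.1) - h (next_state y c.2)).
Proof.
under [RHS]eq_bigr do rewrite mulrBr; rewrite sumrB; congr (_ - _).
  rewrite -(pair_bigA _ (fun a b =>
    max_coupling (action_prob x) (action_prob y) (a, b) * h (next_state x a)))/=.
  apply: eq_bigr => a _; rewrite -mulr_suml max_coupling_suml//;
  exact: action_prob_sum.
rewrite -(pair_bigA _ (fun a b =>
  max_coupling (action_prob x) (action_prob y) (a, b) * h (next_state y b)))/=.
rewrite exchange_big/=.
apply: eq_bigr => a _; rewrite -mulr_suml max_coupling_sumr//;
exact: action_prob_sum.
Qed.

Lemma iter_step_mixing : 0 < error par ->
  exists2 theta, 0 < theta < 1 & forall h, bounded_lipschitz h ->
    exists C, forall n x y, `|iter n step h x - iter n step h y| <= C * theta ^+ n.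
Proof.
move=> /(lyapunov_contraction G)[V [th [th01 _ V42 Vth]]].
have dV x y : l1_dist x y / 4 <= V (l1_dist x y) <= 2.
  by rewrite V42// l1_dist_ge0 l1_dist_le4.
exists th => // h [K K0 hK]; exists (4 * K * 2) => n x y.
(* The induction needs the bound with [V] of the current distance, which contracts under the
   coupling; only at the end is [V] replaced by 2. *)
apply: (@le_trans _ _ (4 * K * V (l1_dist x y) * th ^+ n)); last first.
  have /andP[th0 _] := th01; rewrite ler_wpM2r ?exprn_ge0 ?(ltW th0)//.
  by rewrite ler_wpM2l ?mulr_ge0//; have /andP[] := dV x y.
elim: n x y => [|n IH] x y.
  rewrite expr0 mulr1/=; have [_ /le_trans->//] := hK x y.
  rewrite [4 * K]mulrC -mulrA ler_wpM2l//.
  by have /andP[] := dV x y; rewrite ler_pdivrMr// mulrC.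
rewrite /= step_coupling (le_trans (ler_norm_sum _ _ _))//.
have g0 c : 0 <= max_coupling (action_prob x) (action_prob y) c.
  by apply: max_coupling_ge0 => [a|a|];
    rewrite ?action_prob_sum//; exact: action_prob_ge0.
apply: (@le_trans _ _ (\sum_c max_coupling (action_prob x) (action_prob y) c *
    (4 * K * V (l1_dist (next_state x c.1) (next_state y c.2)) * th ^+ n))).
  by apply: ler_sum => c _; rewrite normrM (ger0_norm (g0 c)) ler_wpM2l.
have /andP[/ltW th0 _] := th01.
apply: (@le_trans _ _ (4 * K * th ^+ n * (th * V (l1_dist x y)))); last first.
  by rewrite le_eqVlt exprS; apply/orP; left; apply/eqP; ring.
apply: le_trans (ler_wpM2l _ (Vth x y)); last by rewrite !mulr_ge0 ?exprn_ge0.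
rewrite mulr_sumr; apply: ler_sum => c _.
by rewrite le_eqVlt; apply/orP; left; apply/eqP; ring.
Qed.

(** For positive error and bounded Lipschitz [h], the iterates converge to this same value from
    every state. *)
Definition ergodic_mean h : R := limn (fun n => iter n step h point).

Hypothesis error_gt0 : 0 < error par.

(** A step averages, so consecutive iterates differ by at most the oscillation of the earlier one,
    which decays geometrically. This gives convergence at [point], and the decay carries it over to
    [x]. *)
Lemma cvg_ergodic_mean h x : bounded_lipschitz h ->
  iter n step h x @[n --> \oo] --> ergodic_mean h.
Proof.
move=> bh; have [th th01 /(_ _ bh)[C hC]] := iter_step_mixing error_gt0.
have ch y n : `|iter n.+1 step h y - iter n step h y| <= C * th ^+ n.
  by rewrite iterS; exact: step_dist.
have [cvx _] := cvg_geometric_increments th01 (ch point).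
have -> : (fun n => iter n step h x) =
    (fun n => iter n step h point + (iter n step h x - iter n step h point)).
  by apply/funext => n; rewrite subrKC.
rewrite -[X in _ --> X]addr0; apply: cvgD => //.
apply/norm_cvg0P; have Ct : C * th ^+ n @[n --> \oo] --> (0 : R).
  rewrite -[X in _ --> X](mulr0 C); apply: cvgMl_tmp; apply: cvg_expr.
  by rewrite gtr0_norm; case/andP: th01.
apply: (squeeze_cvgr _ (cvg_cst 0) Ct).
by near=> n; rewrite normr_ge0 hC.
Unshelve. all: by end_near. Qed.

Lemma ergodic_mean_uniq h x l : bounded_lipschitz h ->
  iter n step h x @[n --> \oo] --> l -> ergodic_mean h = l.
Proof. by move=> /(@cvg_ergodic_mean h x) + hl; move/cvg_unique; apply. Qed.

Lemma ergodic_mean_iter_step h k : bounded_lipschitz h ->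
  ergodic_mean (iter k step h) = ergodic_mean h.
Proof.
move=> bh; apply: (@ergodic_mean_uniq _ point).
  exact: bounded_lipschitz_iter_step.
under eq_fun do rewrite -iterD.
have := @cvg_ergodic_mean _ point bh.
by rewrite -(cvg_shiftn k).
Qed.

Lemma ergodic_mean_cst c : ergodic_mean (fun=> c) = c.
Proof.
apply: (@ergodic_mean_uniq _ point); first exact: bounded_lipschitz_cst.
by under eq_fun do rewrite iter_step_cst; exact: cvg_cst.
Qed.

Lemma ergodic_mean_sum (I : Type) (r : seq I) (c : I -> R) (h : I -> state G -> R) :
  (forall i, bounded_lipschitz (h i)) ->
  ergodic_mean (fun y => \sum_(i <- r) c i * h i y)
  = \sum_(i <- r) c i * ergodic_mean (h i).
Proof.
move=> bh; apply: (@ergodic_mean_uniq _ point).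
  apply: bounded_lipschitz_sum => i _; apply: bounded_lipschitzM => //.
  exact: bounded_lipschitz_cst.
under eq_fun do rewrite iter_step_sum.
apply: (@cvg_sumr _ _ \oo _ _ _ (fun i n => c i * iter n step (h i) point)) => i.
by apply: cvgMl_tmp; exact: cvg_ergodic_mean.
Qed.

Lemma ergodic_mean_dist h h' c : bounded_lipschitz h -> bounded_lipschitz h' ->
  (forall x, `|h x - h' x| <= c) -> `|ergodic_mean h - ergodic_mean h'| <= c.
Proof.
move=> bh bh' hh'.
have hl := @cvg_ergodic_mean _ point bh.
have hl' := @cvg_ergodic_mean _ point bh'.
apply: (cvgr_to_le (cvg_norm (cvgB hl hl'))).
by near=> n; exact: iter_step_dist.
Unshelve. all: by end_near. Qed.

Lemma ergodic_mean_ge0 h : bounded_lipschitz h ->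
  (forall x, 0 <= h x) -> 0 <= ergodic_mean h.
Proof.
move=> bh h0; apply: (cvgr_to_ge (@cvg_ergodic_mean _ point bh)).
near=> n; rewrite -(iter_step_cst 0 n point); exact: le_iter_step.
Unshelve. all: by end_near. Qed.

(* The head of a word is its oldest action, so that a word is refined into the
   past by [cons]. *)
Definition run x (w : seq (action G)) : state G := foldl next_state x w.

Fixpoint word_prob (w : seq (action G)) x : R :=
  if w is a :: w' then action_prob x a * word_prob w' (next_state x a) else 1.

Lemma word_prob_ge0 w x : 0 <= word_prob w x.
Proof. by elim: w x => //= a w IH x; rewrite mulr_ge0 ?action_prob_ge0. Qed.

Lemma bounded_lipschitz_word_prob w : bounded_lipschitz (word_prob w).
Proof.
elim: w => [|a w IH]; first exact: bounded_lipschitz_cst.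
apply: bounded_lipschitzM; first exact: bounded_lipschitz_action_prob.
exact: bounded_lipschitz_next.
Qed.

Lemma l1_dist_run x y w :
  l1_dist (run x w) (run y w) = recency par ^+ size w * l1_dist x y.
Proof.
elim: w x y => [|a w IH] x y /=; first by rewrite mul1r.
by rewrite IH l1_dist_next mulrA -exprSr.
Qed.

End transfer_operator.

(** * Words of actions and their limit masses *)

Fixpoint words (A : finType) (k : nat) : seq (seq A) :=
  if k is k'.+1 then [seq a :: w | w <- words A k', a <- index_enum A] else [:: [::]].

Lemma words_size (A : finType) k w : w \in words A k -> size w = k.
Proof.
elim: k w => [|k IH] w /=; first by rewrite inE => /eqP->.
by move=> /allpairsP[[w' a] /= [/IH <- _ ->]].
Qed.

Lemma sum_words (A : finType) (V : nmodType) k (F : seq A -> V) :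
  \sum_(w <- words A k.+1) F w = \sum_(w <- words A k) \sum_a F (a :: w).
Proof. by rewrite big_allpairs_dep. Qed.

Section word_mass.
Variables (R : realType) (G : game R) (par : rws_param R).
Hypothesis error_gt0 : 0 < error par.
Implicit Types (x y : state G) (h : state G -> R).

Lemma iter_step_words h k x : iter k (step par) h x =
  \sum_(w <- words (action G) k) word_prob par w x * h (run par x w).
Proof.
elim: k x => [|k IH] x; first by rewrite big_seq1 mul1r.
rewrite sum_words exchange_big/=; apply: eq_bigr => a _; rewrite IH mulr_sumr.
by apply: eq_bigr => w _; rewrite mulrA.
Qed.

Definition word_mass (w : seq (action G)) : R := ergodic_mean par (word_prob par w).

Lemma word_mass_nil : word_mass [::] = 1.
Proof. exact: ergodic_mean_cst. Qed.

Lemma word_mass_ge0 w : 0 <= word_mass w.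
Proof.
apply: ergodic_mean_ge0 => // [|x]; first exact: bounded_lipschitz_word_prob.
exact: word_prob_ge0.
Qed.

(** Summing over the oldest action turns [word_prob] into its image under [step], which has the same
    ergodic mean. This consistency makes the cells nest. *)
Lemma word_mass_cons w : \sum_a word_mass (a :: w) = word_mass w.
Proof.
rewrite -[RHS](@ergodic_mean_iter_step _ _ _ error_gt0 _ 1); last first.
  exact: bounded_lipschitz_word_prob.
under eq_bigr do rewrite -[word_mass _]mul1r.
rewrite -ergodic_mean_sum//; last by move=> a; exact: bounded_lipschitz_word_prob.
congr ergodic_mean; apply/funext => x.
by apply: eq_bigr => a _; rewrite mul1r.
Qed.

(** After [k] common actions two starting points are at distance at most [4 * recency par ^+ k], so
    in the expansion of the [k]-th iterate over words the start may be fixed at [x]. *)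
Lemma word_mass_mean h K k x : 0 <= K -> (forall y z, `|h y - h z| <= K * l1_dist y z) ->
  bounded_lipschitz h ->
  `|\sum_(w <- words (action G) k) word_mass w * h (run par x w) - ergodic_mean par h|
    <= 4 * K * recency par ^+ k.
Proof.
move=> K0 hK bh; set S := \sum_(w <- _) _; have /andP[b0 b1] := recency_itv par.
have SE : S = ergodic_mean par (fun y =>
    \sum_(w <- words (action G) k) h (run par x w) * word_prob par w y).
  rewrite ergodic_mean_sum//; last by move=> w; exact: bounded_lipschitz_word_prob.
  by apply: eq_bigr => w _; rewrite mulrC.
have bS : bounded_lipschitz (fun y =>
    \sum_(w <- words (action G) k) h (run par x w) * word_prob par w y).
  apply: bounded_lipschitz_sum => w _; apply: bounded_lipschitzM.
    exact: bounded_lipschitz_cst.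
  exact: bounded_lipschitz_word_prob.
have bI := bounded_lipschitz_iter_step par k bh.
have d y w : w \in words (action G) k ->
    `|h (run par x w) - h (run par y w)| <= 4 * K * recency par ^+ k.
  move=> /words_size wk; apply: le_trans (hK _ _) _.
  rewrite l1_dist_run wk [4 * K]mulrC -mulrA ler_wpM2l//.
  by rewrite mulrC ler_wpM2r ?exprn_ge0 ?l1_dist_le4// ltW.
rewrite SE -(@ergodic_mean_iter_step _ _ _ error_gt0 h k)//.
apply: ergodic_mean_dist => // y; rewrite iter_step_words -sumrB.
apply: le_trans (ler_norm_sum _ _ _) _; rewrite -[leRHS]mul1r.
rewrite -[X in _ <= X * _](iter_step_cst par 1 k y) iter_step_words mulr_suml.
rewrite !big_seq ler_sum// => w wk.
rewrite mulr1 [h _ * _]mulrC -mulrBr normrM ger0_norm ?word_prob_ge0//.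
by rewrite ler_wpM2l ?word_prob_ge0 ?d.
Qed.

End word_mass.

(** * Random words from a uniform point *)

Section unit_law.
Variable R : realType.

Definition unit_law : set (measurableTypeR R) -> \bar R :=
  mrestr lebesgue_measure (measurable_itv `[0%R : R, 1%R[).

HB.instance Definition _ := Measure.on unit_law.

Let unit_law_setT : unit_law setT = 1%E.
Proof.
by rewrite /unit_law /mrestr setTI lebesgue_measure_itv/= lte_fin ltr01 oppr0 adde0.
Qed.

HB.instance Definition _ := Measure_isProbability.Build _ _ _ unit_law unit_law_setT.

End unit_law.
Arguments unit_law : clear implicits.

Section cells.
Variables (R : realType) (A : finType) (a0 : A) (m : seq A -> R).
Hypotheses (m_ge0 : forall w, 0 <= m w) (m_nil : m [::] = 1)
  (m_cons : forall w, \sum_a m (a :: w) = m w).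

Let cum w i : R := \sum_(b | (enum_rank b < i)%N) m (b :: w).

Let cumS w a : cum w (enum_rank a).+1 = cum w (enum_rank a) + m (a :: w).
Proof.
rewrite /cum (bigD1 a)//= addrC; congr (_ + _); apply: eq_bigl => b.
by rewrite ltnS andbC ltn_neqAle (inj_eq val_inj) (inj_eq enum_rank_inj).
Qed.

Let cum_card w : cum w #|A| = m w.
Proof. by rewrite -m_cons; apply: eq_bigl => b; rewrite ltn_ord. Qed.

(** The cells of the words [a :: w'] are laid end to end inside that of [w'], ordered by
    [enum_rank]. *)
Fixpoint cell_start (w : seq A) : R :=
  if w is a :: w' then
    cell_start w' + \sum_(b | (enum_rank b < enum_rank a)%N) m (b :: w')
  else 0.

Definition cell (w : seq A) : set R :=
  `[cell_start w, cell_start w + m w[%classic.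

Lemma measurable_cell w : measurable (cell w).
Proof. exact: measurable_itv. Qed.

Lemma in_cell w u : (u \in cell w) = (cell_start w <= u < cell_start w + m w).
Proof. by apply/idP/idP => [/set_mem|h]; [|apply/mem_set]; rewrite /cell/= in_itv. Qed.

Let in_cellE w u :
  (u \in cell w)%:R = (u < cell_start w + m w)%R%:R - (u < cell_start w)%R%:R :> R.
Proof.
rewrite in_cell; case: (ltP u (cell_start w)) => /= us.
  by rewrite (lt_le_trans us) ?lerDl// subrr.
by rewrite subr0.
Qed.

(** The indicator of a half-open interval is a difference of indicators of two rays, so the sum over
    adjacent cells telescopes. *)
Lemma sum_in_cell_cons w u :
  \sum_a (u \in cell (a :: w))%:R = (u \in cell w)%:R :> R.
Proof.
pose F i : R := (u < cell_start w + cum w i)%R%:R.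
transitivity (\sum_(a : A) (F (enum_rank a).+1 - F (enum_rank a))).
  by apply: eq_bigr => a _; rewrite in_cellE /= /F cumS addrA.
rewrite (reindex (@enum_val A predT)) /=; last first.
  by apply: onW_bij; exact: (Bijective enum_valK enum_rankK).
under eq_bigr do rewrite enum_valK.
rewrite -(big_mkord xpredT (fun i => F i.+1 - F i)) telescope_sumr//.
by rewrite in_cellE /F cum_card /cum big_pred0// addr0.
Qed.

(** The default [a0] occurs only when [u] lies outside the cell of [w]. *)
Definition digit w u : A := odflt a0 [pick a | u \in cell (a :: w)].

(** By the sum of indicators, a point of the cell of [w] lies in exactly one of the subcells, and
    any other point in none. *)
Lemma in_cell_cons a w u :
  (u \in cell (a :: w)) = (u \in cell w) && (a == digit w u).
Proof.
have S := sum_in_cell_cons w u.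
have sub b : u \in cell (b :: w) -> u \in cell w.
  move=> ub; apply/negPn/negP => /negPf uw; move: S; rewrite uw => /eqP.
  by rewrite psumr_eq0// => /allP/(_ b (mem_index_enum _)); rewrite ub/= oner_eq0.
have [uw|uw] := boolP (u \in cell w); last by apply/negP => /sub; rewrite (negPf uw).
rewrite /digit; case: pickP => [b ub|none] /=; last first.
  move: S; rewrite uw big1 => [/eqP|b _]; last by rewrite none.
  by rewrite eq_sym oner_eq0.
have [->//|/negPf ab] := eqVneq a b; apply/negP => ua.
move: S; rewrite uw (bigD1 b)//= (bigD1 a)/= ?ab// ub ua.
rewrite /= addrA; set t := \sum_(i | _) _.
have : 0 <= t by apply: sumr_ge0.
lra.
Qed.

Fixpoint digits u k : seq A :=
  if k is k'.+1 then digit (digits u k') u :: digits u k' else [::].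

Lemma digits_notin u k : u \notin cell [::] -> digits u k = nseq k a0.
Proof.
move=> u0; have uw w : u \notin cell w.
  by elim: w => // a w IH; rewrite in_cell_cons (negPf IH).
elim: k => //= k ->; congr (_ :: _); rewrite /digit.
by case: pickP => // a; rewrite (negPf (uw _)).
Qed.

(** This finite combination of indicators gives both measurability and the integral. The last term
    accounts for points outside the cell of the empty word, where all digits are [a0]. *)
Lemma sum_digits (F : seq A -> R) k u :
  F (digits u k) = \sum_(w <- words A k) F w * (u \in cell w)%:R
    + F (nseq k a0) * (u \notin cell [::])%:R.
Proof.
have [u0|u0] := boolP (u \in cell [::]); last first.
  rewrite digits_notin// big1 ?add0r ?mulr1// => w _.
  suff /negPf-> : u \notin cell w by rewrite mulr0.
  by elim: w => // a w IH; rewrite in_cell_cons (negPf IH).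
rewrite mulr0 addr0; elim: k F => [|k IH] F; first by rewrite big_seq1 u0 mulr1.
(* Among the extensions of [w] only the one by [digit w u] can have [u] in its cell. *)
rewrite sum_words /= (IH (fun w => F (digit w u :: w))); apply: eq_bigr => w _.
rewrite [RHS](bigD1 (digit w u))//= in_cell_cons eqxx andbT [X in _ + X]big1 ?addr0//.
by move=> a /negPf ad; rewrite in_cell_cons ad andbF mulr0.
Qed.

Lemma lebesgue_cell w : lebesgue_measure (cell w) = (m w)%:E.
Proof.
rewrite /cell lebesgue_measure_itv/= lte_fin ltrDl -EFinD addrAC subrr add0r.
by case: ltP => // mw; congr EFin; apply/eqP; rewrite eq_le mw m_ge0.
Qed.

Lemma measurable_digits (F : seq A -> R) k :
  measurable_fun setT (fun u => F (digits u k)).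
Proof.
have mi w : measurable_fun setT (fun u => (u \in cell w)%:R : R).
  rewrite (_ : (fun u => _) = \1_(cell w)); last by apply/funext => u; rewrite indicE.
  exact: measurable_indic (measurable_cell w).
under eq_fun do rewrite sum_digits.
apply: measurable_funD.
  by apply: measurable_sum => w; apply: measurable_funM.
apply: measurable_funM => //.
rewrite (_ : (fun u => _) = (fun u => 1 - (u \in cell [::])%:R)).
  exact: measurable_funB.
by apply/funext => u; case: (u \in _); rewrite ?subrr ?subr0.
Qed.

Lemma cell_nil : cell [::] = `[0, 1[%classic.
Proof. by rewrite /cell /= m_nil add0r. Qed.

Lemma unit_law_cell w : unit_law R (cell w) = (m w)%:E.
Proof.
rewrite /unit_law /mrestr setIidl ?lebesgue_cell// -cell_nil => u /mem_set uw.
apply: set_mem; elim: w uw => // a w IH; rewrite in_cell_cons => /andP[uw _].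
exact: IH.
Qed.

Lemma integral_digits (F : seq A -> R) k : (forall w, 0 <= F w) ->
  (\int[unit_law R]_u (F (digits u k))%:E =
   (\sum_(w <- words A k) m w * F w)%:E)%E.
Proof.
move=> F0; pose g w u : \bar R := ((F w)%:E * (\1_(cell w) u)%:E)%E.
have g0 w u : (0 <= g w u)%E by rewrite mule_ge0// lee_fin.
have mg w : measurable_fun setT (g w).
  apply: emeasurable_funM => //; apply/measurable_EFinP.
  exact: measurable_indic (measurable_cell w).
transitivity (\int[unit_law R]_u (\sum_(w <- words A k) g w u
    + (F (nseq k a0))%:E * (\1_(~` cell [::]) u)%:E))%E.
  apply: eq_integral => u _; rewrite sum_digits EFinD -sumEFin.
  congr (_ + _)%E.
  by rewrite indicE in_setC EFinM.
have mC : measurable (~` cell [::]) by apply: measurableC; exact: measurable_cell.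
rewrite ge0_integralD//; last 4 first.
- by move=> u _; apply: sume_ge0.
- exact: emeasurable_sum.
- by move=> u _; rewrite mule_ge0// lee_fin.
- apply: emeasurable_funM => //; apply/measurable_EFinP.
  exact: measurable_indic.
rewrite ge0_integral_sum// -sumEFin [X in (_ + X)%E](_ : _ = 0%E) ?adde0.
  apply: eq_bigr => w _; rewrite ge0_integralZl//; last 2 first.
  - apply/measurable_EFinP; exact: measurable_indic (measurable_cell w).
  - by rewrite lee_fin.
  rewrite integral_indic//; last exact: measurable_cell.
  rewrite setIT mulrC EFinM; congr (_ * _)%E; exact: unit_law_cell.
rewrite ge0_integralZl//; last 2 first.
- by apply/measurable_EFinP; exact: measurable_indic.
- by rewrite lee_fin.
(* The default words occur only outside [[0, 1[], where [unit_law] has no mass. *)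
rewrite integral_indic// setIT; apply/eqP; rewrite mule_eq0; apply/orP; right.
rewrite -[X in X == _]/(lebesgue_measure (~` cell [::] `&` `[0%R, 1%R[)).
by rewrite -cell_nil setICl measure0.
Qed.

End cells.

(** * The stationary law *)

Lemma le_geometric_eq (R : realType) (r l C q : R) : 0 < q < 1 ->
  (forall k, `|r - l| <= C * q ^+ k) -> r = l.
Proof.
move=> /andP[q0 q1] rl; apply/eqP; rewrite -subr_eq0 -normr_le0.
have Cq : C * q ^+ k @[k --> \oo] --> C * 0.
  by apply: cvgMl_tmp; apply: cvg_expr; rewrite gtr0_norm.
rewrite mulr0 in Cq; apply: (cvgr_to_ge Cq).
by near=> k.
Unshelve. all: by end_near. Qed.

Lemma integral_probability_cst d (T : measurableType d) (R : realType)
    (P : probability T R) (r : R) : (\int[P]_x r%:E = r%:E)%E.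
Proof. by rewrite integral_cst//= probability_setT mule1. Qed.

(** The integral of [f] lies between 0 and [r + e], hence is finite; naming its real value lets
    later comparisons take place in [R]. *)
Lemma integral_dist_le d (T : measurableType d) (R : realType)
    (P : probability T R) (f g : T -> R) (e r : R) :
  measurable_fun setT f -> measurable_fun setT g ->
  (forall x, 0 <= f x) -> (forall x, 0 <= g x) ->
  (forall x, `|f x - g x| <= e) -> (\int[P]_x (g x)%:E = r%:E)%E ->
  exists2 s, (\int[P]_x (f x)%:E = s%:E)%E & `|s - r| <= e.
Proof.
move=> mf mg f0 g0 fg gr.
have e0 : 0 <= e := le_trans (normr_ge0 _) (fg point).
have le (u v : T -> R) : measurable_fun setT u -> measurable_fun setT v ->
    (forall x, 0 <= u x) -> (forall x, 0 <= v x) -> (forall x, u x <= v x + e) ->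
    (\int[P]_x (u x)%:E <= \int[P]_x (v x)%:E + e%:E)%E.
  move=> mu mv u0 v0 uv.
  apply: (@le_trans _ _ (\int[P]_x ((v x)%:E + e%:E))%E).
    apply: ge0_le_integral => //.
    - by move=> x _; rewrite lee_fin.
    - exact/measurable_EFinP.
    - by apply: emeasurable_funD => //; exact/measurable_EFinP.
    - by move=> x _; rewrite -EFinD lee_fin.
  rewrite ge0_integralD//.
  - by rewrite integral_probability_cst.
  - by move=> x _; rewrite lee_fin.
  - exact/measurable_EFinP.
have fge : (\int[P]_x (f x)%:E <= r%:E + e%:E)%E.
  rewrite -gr; apply: le => // x; rewrite -lerBlDl.
  exact: le_trans (ler_norm _) (fg x).
have gfe : (r%:E <= \int[P]_x (f x)%:E + e%:E)%E.
  rewrite -gr; apply: le => // x; rewrite -lerBlDl.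
  by rewrite (le_trans (ler_norm _))// distrC.
have f0' : (0 <= \int[P]_x (f x)%:E)%E by apply: integral_ge0 => x _; rewrite lee_fin.
move: fge gfe f0'; case: (\int[P]_x (f x)%:E)%E => //= s.
rewrite -!EFinD !lee_fin => h1 h2 _; exists s => //.
by rewrite ler_norml; lra.
Qed.

Section state_limit.
Variables (R : realType) (G : game R).

Lemma simplex_lim n (z : nat -> 'rV[R]_n) :
  (forall k, simplex (z k)) -> (forall s, cvgn (fun k => z k 0 s)) ->
  simplex (\row_s limn (fun k => z k 0 s)).
Proof.
move=> sz cz; split=> [s|].
  rewrite mxE; apply: limr_ge => //; near=> k.
  by have [] := sz k.
under eq_bigr do rewrite mxE.
have e1 : \sum_s z k 0 s @[k --> \oo] --> \sum_s limn (fun k => z k 0 s).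
  exact: (@cvg_sumr _ _ \oo _ _ _ (fun s k => z k 0 s)).
have e2 : \sum_s z k 0 s @[k --> \oo] --> (1 : R).
  by under eq_fun do rewrite (sz _).2; exact: cvg_cst.
exact: (cvg_unique _ e1 e2).
Unshelve. all: by end_near. Qed.

(** Each coordinate has geometric increments, and the simplex conditions pass to the limit; adding
    the coordinate errors gives the factor [nstrat1 G + nstrat2 G]. *)
Lemma state_limit (z : nat -> state G) (C q : R) : 0 < q < 1 ->
  (forall k, l1_dist (z k.+1) (z k) <= C * q ^+ k) ->
  exists l, forall k,
    l1_dist (z k) l <= (nstrat1 G + nstrat2 G)%:R * (C / (1 - q)) * q ^+ k.
Proof.
move=> q01 zC.
have c1 s : _ := cvg_geometric_increments q01
  (fun k => le_trans (l1_dist_coord1 (z k.+1) (z k) s) (zC k)).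
have c2 s : _ := cvg_geometric_increments q01
  (fun k => le_trans (l1_dist_coord2 (z k.+1) (z k) s) (zC k)).
have s1 := @simplex_lim _ (fun k => (val (z k)).1) (fun k => (stateP (z k)).1)
  (fun s => (c1 s).1).
have s2 := @simplex_lim _ (fun k => (val (z k)).2) (fun k => (stateP (z k)).2)
  (fun s => (c2 s).1).
exists (exist (fun y => y \in square G) (_, _) (mem_set (conj s1 s2))) => k.
have -> (n1 n2 : nat) : (n1 + n2)%:R * (C / (1 - q)) * q ^+ k =
    \sum_(s < n1) C * q ^+ k / (1 - q) + \sum_(s < n2) C * q ^+ k / (1 - q).
  by rewrite !sumr_const !card_ord -mulrnDr -mulrA mulrAC mulr_natl.
rewrite /l1_dist lerD// ler_sum// => s _; rewrite /= mxE.
  exact: (c1 s).2.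
exact: (c2 s).2.
Qed.

End state_limit.

Section stationary_law.
Variables (R : realType) (G : game R) (par : rws_param R).
Hypothesis error_gt0 : 0 < error par.

Definition action0 : action G :=
  (Ordinal (nstrat1_gt0 G), Ordinal (nstrat2_gt0 G)).

Definition past_state (u : measurableTypeR R) k : state G :=
  run par point (digits action0 (word_mass par) u k).

Lemma size_digits (A : finType) (a0 : A) (m : seq A -> R) u k :
  size (digits a0 m u k) = k.
Proof. by elim: k => //= k ->. Qed.

(** One more digit prepends an older action, which only changes the state from which the same [k]
    later actions are run. *)
Lemma past_state_limit : exists (X : measurableTypeR R -> state G) C, forall u k,
  l1_dist (past_state u k) (X u) <= C * recency par ^+ k.
Proof.
have inc u k : l1_dist (past_state u k.+1) (past_state u k) <= 4 * recency par ^+ k.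
  rewrite /past_state /= l1_dist_run size_digits mulrC.
  rewrite ler_wpM2r ?l1_dist_le4// exprn_ge0//.
  by have /andP[/ltW] := recency_itv par.
have /choice[X XP] := fun u => state_limit (recency_itv par) (inc u).
by exists X; eexists; exact: XP.
Qed.

(** The function is a pointwise limit of functions of finitely many digits. *)
Lemma measurable_lipschitz_limit (X : measurableTypeR R -> state G) C h :
  (forall u k, l1_dist (past_state u k) (X u) <= C * recency par ^+ k) ->
  bounded_lipschitz h -> measurable_fun setT (fun u => h (X u)).
Proof.
move=> XC [K K0 hK].
apply: (@measurable_fun_cvg _ _ _ _ (fun k u => h (past_state u k))).
  move=> k.
  exact: (measurable_digits action0 (word_mass_ge0 error_gt0) (word_mass_cons error_gt0)
    (fun w => h (run par point w))).
move=> u _; have /andP[b0 b1] := recency_itv par.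
apply/cvgrPdist_le => e e0.
have Cb : K * C * recency par ^+ k @[k --> \oo] --> K * C * 0.
  by apply: cvgMl_tmp; apply: cvg_expr; rewrite gtr0_norm.
have /cvgrPdist_le/(_ e e0) := Cb; apply: filterS => k.
rewrite mulr0 sub0r normrN => /(le_trans (ler_norm _)); apply: le_trans.
rewrite distrC; have [_ /le_trans->//] := hK (past_state u k) (X u).
by rewrite -mulrA ler_wpM2l.
Qed.

(** An open set is where the Lipschitz function [inf_dist] of its complement does not vanish. *)
Lemma measurable_state_fun d (T : measurableType d) (X : T -> state G) :
  (forall h, bounded_lipschitz h -> measurable_fun setT (fun u => h (X u))) ->
  measurable_fun setT X.
Proof.
move=> hX; apply: (measurability (@open (state G))) => // _ [U oU <-].
rewrite setTI; have cU : closed (~` U) by exact: open_closedC.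
have [U0|/set0P U0] := eqVneq (~` U) set0.
  by rewrite -[U]setCK U0 setC0 preimage_setT.
have mU := hX _ (bounded_lipschitz_inf_dist U0).
rewrite (_ : X @^-1` U = ~` ((fun u => inf_dist (~` U) (X u)) @^-1` [set 0])).
  by apply: measurableC; rewrite -[X in measurable X]setTI; exact: mU.
rewrite -[LHS]setCK; congr (~` _); apply/seteqP; split=> u /=.
  by move=> Uu; apply/eqP; rewrite inf_dist_eq0//; apply/mem_set.
by move=> /eqP; rewrite inf_dist_eq0// => /set_mem.
Qed.

(** The law is that of [X u] for uniform [u]. At depth [k] the integral of [h] is compared with a
    finite sum over words, and this sum with the ergodic mean. *)
Lemma stationary_law : exists mu : probability (state G) R,
  forall h, bounded_lipschitz h -> (forall x, 0 <= h x) ->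
    (\int[mu]_x (h x)%:E = (ergodic_mean par h)%:E)%E.
Proof.
have [X [C XC]] := past_state_limit.
have mhX h := measurable_lipschitz_limit XC (h := h).
have mX : measurable_fun setT X := measurable_state_fun mhX.
pose Xm : {mfun measurableTypeR R >-> state G} := mfun_Sub (mem_set mX).
exists (distribution (unit_law R) Xm) => h bh h0.
rewrite ge0_integral_pushforward//; last 2 first.
- apply/measurable_EFinP; exact: bounded_lipschitz_measurable.
- by move=> x _; rewrite lee_fin.
rewrite preimage_setT /=; have [K K0 hK] := bh.
have near k : exists2 s, (\int[unit_law R]_u (h (X u))%:E = s%:E)%E &
    `|s - \sum_(w <- words (action G) k) word_mass par w * h (run par point w)|
      <= K * C * recency par ^+ k.
  apply: (@integral_dist_le _ _ _ (unit_law R) _ (fun u => h (past_state u k))) => //.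
  - exact: mhX.
  - exact: (measurable_digits action0 (word_mass_ge0 error_gt0)
      (word_mass_cons error_gt0) (fun w => h (run par point w))).
  - move=> u; rewrite distrC.
    have [_ /le_trans->//] := hK (past_state u k) (X u).
    by rewrite -mulrA ler_wpM2l.
  - exact: (integral_digits action0 (word_mass_ge0 error_gt0) (word_mass_nil G error_gt0)
      (word_mass_cons error_gt0) k (F := fun w => h (run par point w)) (fun w => h0 _)).
have [s sE _] := near 0%N; rewrite sE; congr EFin.
(* [K * C] is the cost of cutting the past at depth [k], and [4 * K] comes from [word_mass_mean]. *)
apply: (le_geometric_eq (C := K * C + 4 * K) (recency_itv par)) => k.
have [s' s'E s's] := near k; move: s'E; rewrite sE => -[ss']; subst s'.
set S := \sum_(w <- _) _ in s's.
have Sm := word_mass_mean error_gt0 k point K0 (fun y z => (hK y z).2) bh.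
rewrite -(subrKA S) (le_trans (ler_normD _ _))// mulrDl lerD//.
Qed.

End stationary_law.

(** * Uniqueness and the coupling bound *)

Section lipschitz_determining.
Variables (R : realType) (G : game R).

(** Bump functions and dominated convergence give equality on closed sets, hence on open sets, which
    are stable under intersection and generate the sigma-algebra. *)
Lemma lipschitz_determining (mu nu : probability (state G) R) :
  (forall h, bounded_lipschitz h -> (forall x, 0 <= h x) ->
    (\int[mu]_x (h x)%:E = \int[nu]_x (h x)%:E)%E) ->
  forall B, measurable B -> mu B = nu B.
Proof.
move=> mn; have mClosed (C : set (state G)) : closed C -> measurable C.
  move=> cC; rewrite -[C]setCK; apply: measurableC; apply: sub_sigma_algebra.
  exact: closed_openC.
have cvC (P : probability (state G) R) (C : set (state G)) : closed C -> C !=set0 ->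
    (\int[P]_x (bump_fun C n x)%:E @[n --> \oo] --> P C)%E.
  move=> cC C0; rewrite -[C in P C]setIT -integral_indic//; last exact: mClosed.
  apply: (@dominated_cvg _ _ _ P _ _ (fun n x => (bump_fun C n x)%:E) _ (cst 1%E)) => //.
  - move=> n; apply/measurable_EFinP; apply: bounded_lipschitz_measurable.
    exact: bounded_lipschitz_bump.
  - move=> x _; apply: cvg_EFin; first exact: nearW.
    exact: cvg_bump_fun.
  - apply/integrableP; split=> //.
    under eq_integral do rewrite /= normr1.
    by rewrite integral_probability_cst ltry.
  - move=> n x _; rewrite /= lee_fin ger0_norm ?bump_fun_ge0//.
    exact: bump_fun_le1.
have mnC C : closed C -> mu C = nu C.
  move=> cC; have [->|/set0P C0] := eqVneq C set0; first by rewrite !measure0.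
  have cmu := cvC mu C cC C0; have cnu := cvC nu C cC C0.
  have e : (fun n => \int[mu]_x (bump_fun C n x)%:E)%E =
      (fun n => \int[nu]_x (bump_fun C n x)%:E)%E.
    apply/funext => n; apply: mn => [|x]; first exact: bounded_lipschitz_bump.
    exact: bump_fun_ge0.
  by rewrite e in cmu; exact: (cvg_unique _ cmu cnu).
move=> B mB; apply: (@measure_unique _ _ _ (@open (state G)) (fun=> setT)) => //.
- exact: openI.
- by move=> _; exact: openT.
- by rewrite bigcup_const.
- move=> U oU; have cU := open_closedC oU.
  rewrite -[LHS]/(mu U) -[RHS]/(nu U).
  have mcU := mClosed _ cU.
  by rewrite -[U]setCK (probability_setC mu)// (probability_setC nu)// mnC.
- by move=> _; apply: (@le_lt_trans _ _ 1%E); [exact: probability_le1 | exact: ltry].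
Qed.

End lipschitz_determining.

Section invariant_law.
Variables (R : realType) (G : game R) (par : rws_param R).
Hypothesis error_gt0 : 0 < error par.
Implicit Types (x : state G) (h : state G -> R).

Lemma integral_rws_step (nu : probability (state G) R) h :
  bounded_lipschitz h -> (forall x, 0 <= h x) ->
  (\int[kernel_step (rws_kernel par) nu]_x (h x)%:E
   = \int[nu]_x (step par h x)%:E)%E.
Proof.
move=> bh h0.
have mh : measurable_fun setT (fun x => (h x)%:E).
  by apply/measurable_EFinP; exact: bounded_lipschitz_measurable.
rewrite integral_kernel_step//.
apply: eq_integral => x _.
rewrite integral_rws_kernel//.
by rewrite -sumEFin; apply: eq_bigr => a _; rewrite EFinM.
Qed.

Lemma step_ge0 h x : (forall y, 0 <= h y) -> 0 <= step par h x.
Proof.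
by move=> h0; apply: sumr_ge0 => a _; rewrite mulr_ge0 ?action_prob_ge0.
Qed.

(** Invariance allows [h] to be replaced by its iterates, which converge uniformly to the ergodic
    mean. *)
Lemma integral_invariant_law (mu : probability (state G) R) h :
  invariant_law (rws_kernel par) mu ->
  bounded_lipschitz h -> (forall x, 0 <= h x) ->
  (\int[mu]_x (h x)%:E = (ergodic_mean par h)%:E)%E.
Proof.
move=> inv bh h0.
have bI n := bounded_lipschitz_iter_step par n bh.
have I0 n x : 0 <= iter n (step par) h x.
  by elim: n x => //= n IH x; exact: step_ge0.
have iterE n : (\int[mu]_x (h x)%:E = \int[mu]_x (iter n (step par) h x)%:E)%E.
  elim: n => //= n ->; rewrite -integral_rws_step//.
  apply: eq_measure_integral => A mA _; exact: esym (inv _ mA).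
have [th th01 /(_ _ bh)[C hC]] := iter_step_mixing G error_gt0.
have near n : exists2 s, (\int[mu]_x (h x)%:E = s%:E)%E &
    `|s - ergodic_mean par h| <= C * th ^+ n.
  rewrite (iterE n); apply: (integral_dist_le (g := fun=> ergodic_mean par h)) => //.
  - exact: bounded_lipschitz_measurable.
  - by move=> _; exact: ergodic_mean_ge0.
  (* Both numbers are ergodic means: of the iterate, and of the constant function with its value at
     [x]. The oscillation of the iterate bounds their difference. *)
  - move=> x; rewrite distrC -(@ergodic_mean_iter_step _ _ _ error_gt0 h n)//.
    rewrite -[X in _ - X](ergodic_mean_cst G error_gt0).
    by apply: ergodic_mean_dist => //; exact: bounded_lipschitz_cst.
  - exact: integral_probability_cst.
have [s sE _] := near 0%N; rewrite sE; congr EFin.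
apply: (le_geometric_eq (C := C) th01) => k.
by have [s' s'E s's] := near k; move: s'E; rewrite sE => -[->].
Qed.

(** A step preserves the ergodic mean, so the stationary law and its image under the kernel give the
    same integrals. *)
Lemma exists_invariant_law : exists mu : probability (state G) R,
  invariant_law (rws_kernel par) mu.
Proof.
have [mu muE] := stationary_law G error_gt0; exists mu.
apply: lipschitz_determining => h bh h0.
rewrite integral_rws_step// !muE//; last 2 first.
- exact: bounded_lipschitz_step.
- by move=> x; exact: step_ge0.
by rewrite -(@ergodic_mean_iter_step _ _ _ error_gt0 h 1).
Qed.

Lemma invariant_law_uniq (mu nu : probability (state G) R) :
  invariant_law (rws_kernel par) mu -> invariant_law (rws_kernel par) nu ->
  forall B, measurable B -> mu B = nu B.
Proof.
move=> imu inu; apply: lipschitz_determining => h bh h0.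
by rewrite !integral_invariant_law.
Qed.

End invariant_law.

(** * The coupled chain on pairs of states *)

Section coupled_chain.
Variables (R : realType) (G : game R) (par : rws_param R).

Definition coupled_weight (c : action G * action G) (z : state G * state G) : R :=
  max_coupling (action_prob par z.1) (action_prob par z.2) c.

Definition coupled_next (c : action G * action G) (z : state G * state G) :=
  (next_state par z.1 c.1, next_state par z.2 c.2).

Lemma coupled_weight_ge0 c z : 0 <= coupled_weight c z.
Proof.
by apply: max_coupling_ge0 => [a|a|]; rewrite ?action_prob_sum//;
  exact: action_prob_ge0.
Qed.

Lemma coupled_weight_sum z : \sum_c coupled_weight c z = 1.
Proof. by rewrite max_coupling_sum ?action_prob_sum. Qed.

Lemma measurable_action_prob1 a :
  measurable_fun setT (fun z : state G * state G => action_prob par z.1 a).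
Proof.
apply: (measurableT_comp (f := fun x => action_prob par x a)) => //.
by apply: bounded_lipschitz_measurable; exact: bounded_lipschitz_action_prob.
Qed.

Lemma measurable_action_prob2 a :
  measurable_fun setT (fun z : state G * state G => action_prob par z.2 a).
Proof.
apply: (measurableT_comp (f := fun x => action_prob par x a)) => //.
by apply: bounded_lipschitz_measurable; exact: bounded_lipschitz_action_prob.
Qed.

Lemma measurable_coupled_weight c : measurable_fun setT (coupled_weight c).
Proof.
have m1 := measurable_action_prob1; have m2 := measurable_action_prob2.
have mmin a : measurable_fun setT (fun z : state G * state G =>
  Num.min (action_prob par z.1 a) (action_prob par z.2 a)).
  exact: measurable_minr.
apply: measurable_funD; first exact: measurable_funM.
apply: measurable_funM.
  by apply: measurable_funM; apply: measurable_maxr => //; exact: measurable_funB.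
(* The divisor is nonnegative, so its inverse is a real power, which is a measurable function. *)
under eq_fun => z.
  rewrite -powR_inv1; last by rewrite subr_ge0 overlap_le1// action_prob_sum.
  over.
apply: (measurableT_comp (measurable_powR _)).
by apply: measurable_funB => //; exact: measurable_sum.
Qed.

Lemma measurable_next_state a : measurable_fun setT (fun x : state G => next_state par x a).
Proof. apply: measurable_continuous_stateT; exact: continuous_rws_next. Qed.

Lemma measurable_coupled_next c : measurable_fun setT (coupled_next c).
Proof.
apply: measurable_fun_pair.
  exact: (measurableT_comp (measurable_next_state c.1) measurable_fst).
exact: (measurableT_comp (measurable_next_state c.2) measurable_snd).
Qed.

Definition coupled_kernel : R.-pker (state G * state G)%type ~> (state G * state G)%type :=
  mixture coupled_weight_ge0 coupled_weight_sum measurable_coupled_weight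
    measurable_coupled_next.

Lemma coupled_kernel_fst z B :
  coupled_kernel z (B `*` setT) = rws_kernel par z.1 B.
Proof.
rewrite rws_kernelE /coupled_kernel mixtureE /coupled_weight.
rewrite -(pair_bigA _ (fun a b => (coupled_weight (a, b) z *
  \1_(B `*` setT) (coupled_next (a, b) z))%:E))/=.
apply: eq_bigr => a _; rewrite sumEFin; congr EFin.
rewrite -(max_coupling_suml a (action_prob_sum par z.1) (action_prob_sum par z.2)).
rewrite mulr_suml; apply: eq_bigr => b _; congr (_ * _).
by rewrite !indicE in_setX in_setT andbT.
Qed.

Lemma coupled_kernel_snd z B :
  coupled_kernel z (setT `*` B) = rws_kernel par z.2 B.
Proof.
rewrite rws_kernelE /coupled_kernel mixtureE /coupled_weight.
rewrite -(pair_bigA _ (fun a b => (coupled_weight (a, b) z *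
  \1_(setT `*` B) (coupled_next (a, b) z))%:E))/= exchange_big/=.
apply: eq_bigr => b _; rewrite sumEFin; congr EFin.
rewrite -(max_coupling_sumr b (action_prob_sum par z.1) (action_prob_sum par z.2)).
rewrite mulr_suml; apply: eq_bigr => a _; congr (_ * _).
by rewrite !indicE in_setX in_setT.
Qed.

(** The coupled kernel has the marginals of the chain, each depending on one component only, so
    integrals over [pi] reduce to its marginals. *)
Lemma coupling_kernel_step (mu nu : probability (state G) R)
    (pi : probability (state G * state G)%type R) : coupling mu nu pi ->
  coupling (kernel_step (rws_kernel par) mu) (kernel_step (rws_kernel par) nu)
    (kernel_step coupled_kernel pi).
Proof.
move=> cpl B mB; rewrite /= /kernel_step; split.
  under eq_integral do rewrite coupled_kernel_fst.
  rewrite -(@ge0_integral_pushforward _ _ _ _ _ fst measurable_fst pi setT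
    (fun x => rws_kernel par x B))//; last exact: measurable_kernel.
  apply: eq_measure_integral => A mA _.
  transitivity (pi (A `*` setT)); last exact: (cpl A mA).1.
  by congr (pi _); apply/seteqP; split => -[x y] /=; [split | case].
under eq_integral do rewrite coupled_kernel_snd.
rewrite -(@ge0_integral_pushforward _ _ _ _ _ snd measurable_snd pi setT
  (fun x => rws_kernel par x B))//; last exact: measurable_kernel.
apply: eq_measure_integral => A mA _.
transitivity (pi (setT `*` A)); last exact: (cpl A mA).2.
by congr (pi _); apply/seteqP; split => -[x y] /=; [split | case].
Qed.

Lemma coupling_law_at (mu nu : probability (state G) R) pi n :
  coupling mu nu pi ->
  coupling (law_at (rws_kernel par) mu n) (law_at (rws_kernel par) nu n)
    (law_at coupled_kernel pi n).
Proof. by move=> cpl; elim: n => //= n; exact: coupling_kernel_step. Qed.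

Lemma integral_coupled_le (F : state G * state G -> R) theta
    (pi : probability (state G * state G)%type R) n :
  0 <= theta -> measurable_fun setT F -> (forall z, 0 <= F z <= 2) ->
  (forall z, \sum_c coupled_weight c z * F (coupled_next c z) <= theta * F z) ->
  (\int[law_at coupled_kernel pi n]_z (F z)%:E <= (2 * theta ^+ n)%:E)%E.
Proof.
move=> th0 mF F02 QF.
have mF' : measurable_fun setT (EFin \o F) by exact/measurable_EFinP.
have F0 z : (0 <= (F z)%:E)%E by rewrite lee_fin; have /andP[] := F02 z.
elim: n => [|n IH].
  rewrite mulr1 -(integral_probability_cst pi 2); apply: ge0_le_integral => //.
  by move=> z _; rewrite lee_fin; have /andP[] := F02 z.
rewrite /law_at iterS -/(law_at _ _ _) integral_kernel_step//.
apply: (@le_trans _ _ (\int[law_at coupled_kernel pi n]_z (theta%:E * (F z)%:E))%E).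
  apply: ge0_le_integral => //.
  - by move=> z _; exact: integral_ge0.
  - by apply: measurable_fun_integral_kernel => //; exact: measurable_kernel.
  - by apply: emeasurable_funM.
  - move=> z _; rewrite [leLHS](integral_mixture _ _ _ _ z F0 mF').
    apply: (@le_trans _ _ (theta * F z)%:E); last by rewrite EFinM.
    by rewrite sumEFin lee_fin; exact: QF.
rewrite ge0_integralZl// exprS mulrCA EFinM lee_wpmul2l//.
Qed.

End coupled_chain.

Section product_probability.
Context d (T : measurableType d) (R : realType).
Variables mu nu : probability T R.

(** The independent coupling serves as the initial law of the coupled chain. *)
Definition product_probability : set (T * T) -> \bar R := (mu \x nu)%E.

HB.instance Definition _ := Measure.on product_probability.

Let product_probability_setT : product_probability setT = 1%E.
Proof.
rewrite -setXTT; transitivity (mu setT * nu setT)%E.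
  exact: product_measure1E.
by rewrite !probability_setT mul1e.
Qed.

HB.instance Definition _ :=
  Measure_isProbability.Build _ _ _ product_probability product_probability_setT.

Lemma coupling_product : coupling mu nu product_probability.
Proof.
move=> B mB; split.
  transitivity (mu B * nu setT)%E; first exact: product_measure1E.
  by rewrite probability_setT mule1.
transitivity (mu setT * nu B)%E; first exact: product_measure1E.
by rewrite probability_setT mul1e.
Qed.

End product_probability.

Section measurable_distances.
Variables (R : realType) (G : game R).

Let mcoord1 s : measurable_fun setT
  (fun z : state G * state G => (val z.1).1 0 s - (val z.2).1 0 s).
Proof.
apply: measurable_funB.
  exact: (measurableT_comp (measurable_coord1 s) measurable_fst).
exact: (measurableT_comp (measurable_coord1 s) measurable_snd).
Qed.

Let mcoord2 s : measurable_fun setT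
  (fun z : state G * state G => (val z.1).2 0 s - (val z.2).2 0 s).
Proof.
apply: measurable_funB.
  exact: (measurableT_comp (measurable_coord2 s) measurable_fst).
exact: (measurableT_comp (measurable_coord2 s) measurable_snd).
Qed.

Lemma measurable_l1_dist :
  measurable_fun setT (fun z : state G * state G => l1_dist z.1 z.2).
Proof.
by apply: measurable_funD; apply: measurable_sum => s;
  apply: measurableT_comp.
Qed.

Lemma measurable_euclid_dist :
  measurable_fun setT (fun z : state G * state G => euclid_dist z.1 z.2).
Proof.
apply: (@measurableT_comp _ _ _ _ _ _ (@Num.sqrt R)).
  by apply: continuous_measurable_fun; exact: sqrt_continuous.
apply: measurable_funD; apply: measurable_sum => s; apply: measurable_funX.
  by under eq_fun do rewrite !mxE; exact: mcoord1.
by under eq_fun do rewrite !mxE; exact: mcoord2.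
Qed.

End measurable_distances.

(** * From the coupled chain to the Wasserstein distance *)

(** The infimum is nonnegative, so the power [a] undoes the root; [pi] is one of the competitors. *)
Lemma wasserstein_le d (T : measurableType d) (R : realType) (dist : T -> T -> R)
    (a e : R) (mu nu : probability T R) (pi : probability (T * T)%type R) :
  0 < a -> coupling mu nu pi ->
  (\int[pi]_z (dist z.1 z.2 `^ a)%:E <= e%:E)%E ->
  (poweR (wasserstein dist a mu nu) a <= e%:E)%E.
Proof.
move=> a0 cpl pie; rewrite /wasserstein -poweRrM mulVf ?gt_eqF// poweRe1.
  by apply: le_trans pie; apply: ereal_inf_lbound; exists pi.
apply: le_ereal_inf_tmp => _ [pi' _ <-]; apply: integral_ge0 => z _.
by rewrite lee_fin powR_ge0.
Qed.

(** The quotient [l1_dist x y / 4] is at most 1, so its power of order [a >= 1] is at most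
    itself. *)
Lemma euclid_powR_le (R : realType) (G : game R) (x y : state G) a : 1 <= a ->
  euclid_dist x y `^ a <= 4 `^ a * (l1_dist x y / 4).
Proof.
move=> a1; have a0 : 0 <= a by apply: le_trans a1.
apply: (@le_trans _ _ (l1_dist x y `^ a)).
  by rewrite ge0_ler_powR ?nnegrE ?euclid_dist_ge0 ?l1_dist_ge0// euclid_dist_le.
have t0 := l1_dist_ge0 x y; have t4 := l1_dist_le4 x y.
have [->|tn0] := eqVneq (l1_dist x y) 0.
  by rewrite mul0r mulr0 powR0// gt_eqF// (lt_le_trans ltr01).
rewrite -[X in X `^ a <= _](@divfK _ 4)// mulrC powRM ?divr_ge0//.
have d0 : 0 < l1_dist x y by rewrite lt_neqAle eq_sym tn0.
by rewrite ler_wpM2l ?powR_ge0// ge1r_powR// divr_gt0//= ler_pdivrMr// mul1r.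
Qed.

Theorem theorem3 (R : realType) :
  exists c : R -> R -> R,
  forall (G : game R) (par : rws_param R),
    0 < error par ->
    1 - (maxn (nstrat1 G) (nstrat2 G))%:R^-1 < recency par ->
  exists mu : probability (state G) R,
    [/\ invariant_law (rws_kernel par) mu,
        (forall mu' : probability (state G) R,
           invariant_law (rws_kernel par) mu' ->
           forall B, measurable B -> mu' B = mu B)
      & exists theta : R, 0 < theta < 1 /\
        forall a : R, 1 <= a ->
          0 < c (max_norm G) a /\
          forall (n : nat) (nu : probability (state G) R),
            (poweR (wasserstein (@euclid_dist R G) a
                      (law_at (rws_kernel par) nu n) mu) a
             <= (c (max_norm G) a * theta ^+ n)%:E)%E].
Proof.
(* The power of 4 comes from [euclid_powR_le], the factor 2 from the upper bound for [V]. *)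
exists (fun _ a => 4 `^ a * 2) => G par error_gt0 _.
have [mu inv] := exists_invariant_law G error_gt0; exists mu; split=> //.
  by move=> mu' inv'; exact: (invariant_law_uniq error_gt0).
have [V [theta [th01 mV V42 QV]]] := lyapunov_contraction G error_gt0.
exists theta; split=> // a a1; split; first by rewrite mulr_gt0 ?powR_gt0.
move=> n nu; have a0 : 0 < a := lt_le_trans ltr01 a1.
have /andP[th0 _] := th01.
have V4 x y : l1_dist x y / 4 <= V (@l1_dist R G x y) <= 2.
  by rewrite V42// l1_dist_ge0 l1_dist_le4.
have mVd : measurable_fun setT (fun z : state G * state G => V (l1_dist z.1 z.2)).
  exact: measurableT_comp mV (@measurable_l1_dist R G).
have V0 x y : 0 <= V (@l1_dist R G x y).
  by have /andP[+ _] := V4 x y; apply: le_trans; rewrite divr_ge0 ?l1_dist_ge0.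
(* The second copy starts in the invariant law and keeps it, so the coupled law at time [n] couples
   the law of the chain with [mu]. *)
have mu_n k B : measurable B -> law_at (rws_kernel par) mu k B = mu B.
  elim: k B => //= k IH B mB; rewrite -(inv B mB).
  by apply: eq_measure_integral => A mA _; exact: IH.
pose pi := law_at (coupled_kernel G par) (product_probability nu mu) n.
apply: (@wasserstein_le _ _ _ _ _ _ _ _ pi) => //.
  move=> B mB; have [c1 c2] := coupling_law_at par n (@coupling_product _ _ _ nu mu) mB.
  by split=> //; rewrite c2 mu_n.
apply: (@le_trans _ _ (\int[pi]_z ((4 `^ a)%:E * (V (l1_dist z.1 z.2))%:E))%E).
  apply: ge0_le_integral => //.
  - by move=> z _; rewrite lee_fin powR_ge0.
  - apply/measurable_EFinP; apply: (measurableT_comp (measurable_powR _)).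
    exact: measurable_euclid_dist.
  - by apply: emeasurable_funM => //; exact/measurable_EFinP.
  - move=> z _; rewrite -EFinM lee_fin; apply: le_trans (euclid_powR_le _ _ a1) _.
    by rewrite ler_wpM2l ?powR_ge0//; have /andP[] := V4 z.1 z.2.
rewrite ge0_integralZl//; last 2 first.
- exact/measurable_EFinP.
- by move=> z _; rewrite lee_fin.
rewrite -mulrA EFinM lee_wpmul2l ?lee_fin ?powR_ge0//.
apply: integral_coupled_le => //; first exact: ltW.
- by move=> z; rewrite V0; have /andP[] := V4 z.1 z.2.
- by move=> z; exact: QV.
Qed.
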